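(* Let $G^{\nu}$ be a wconnected transfinite wgraph of rank $\nu$, $2\le\nu\le\omega$ (possibly $\nu=\vec{\omega}$), let $\rho\le\nu$ be either a natural number or $\omega$ (but not $\vec{\omega}$), and let $S^{\rho}$ be a $\rho$-wsection of $G^{\nu}$. Suppose that the enlargement ${}^{*}\!S^{\rho}$ of $S^{\rho}$ has a $\rho$-hypernode that is not in the principal $\rho$-galaxy $\Gamma_0^{\rho}$ of ${}^{*}\!S^{\rho}$. Then the set of $\rho$-galaxies of ${}^{*}\!S^{\rho}$ is partially ordered according to the closeness of the $\rho$-galaxies to the principal $\rho$-galaxy $\Gamma_0^{\rho}$.
   Context: **Ranks.** Ranks are ordered $0<1<2<\cdots<\vec{\omega}<\omega$ ($\vec{\omega}$ is a special rank preceding $\omega$; $\omega-1$ means $\vec{\omega}$). Sums of ordinals are natural (Hessenberg) sums, ordinals being in normal form. **Wgraphs.** A $0$-wgraph is a graph $\{X^0,B\}$ with $X^0$ a set of $0$-nodes (also called $0$-wnodes) and $B$ a set of branches (two-element subsets of $X^0$). A (nontrivial) $0$-walk is an alternating sequence $\langle\dots,x_m,b_m,x_{m+1},b_{m+1},\dots\rangle$ of $0$-nodes and branches with $b_m=\{x_m,x_{m+1}\}$, having at least one branch; it is two-ended (finite, ending at $0$-nodes), one-ended, or endless; repetitions are allowed. For each rank $\alpha$, two one-ended $\alpha$-walks are equivalent if they are eventually identical (up to a shift of indices); the equivalence classes are the $\alpha$-wtips, whose members are called representatives. For $\mu\in\{1,2,\dots\}\cup\{\omega\}$, given a $(\mu-1)$-wgraph,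 partition its set of $(\mu-1)$-wtips into nonempty subsets $T_\tau$; for each $\tau$ let $X_\tau$ be empty or a singleton containing an $\alpha$-wnode with $\alpha<\mu$, where no wnode is such an exceptional element of two different wnodes; each $x^\mu_\tau=T_\tau\cup X_\tau$ is a $\mu$-wnode. A wnode embraces itself, its elements, and everything embraced by its exceptional element. $X^\mu$ is the set of $\mu$-wnodes and $\{X^0,B,X^1,\dots,X^\mu\}$ is a $\mu$-wgraph. An $\vec{\omega}$-wgraph has wnode sets $X^\mu$ for all natural $\mu$, and a (possibly empty) set $X^{\vec{\omega}}$ of $\vec{\omega}$-wnodes, i.e. infinite sequences of wnodes of strictly increasing natural ranks, each embracing its predecessor. All $X^\rho$ are nonempty for $\rho\neq\vec{\omega}$. **Walks.** A walk reaches a wnode $x$ at one of its ends if its terminal wnode there is embraced by $x$, or if it is infinite there and the corresponding wtip is embraced by $x$. For $\mu\in\{1,2,\dots\}\cup\{\omega\}$ a $\mu$-walk is an alternating sequence $\langle\dots,x_m,W_m,x_{m+1},W_{m+1},\dots\rangle$ in which interior $x_m$ are $\mu$-wnodes, terminal $x_m$ (if any) are wnodes of rank $\le\mu$, each $W_m$ is a nontrivial walk of rank $\alpha_m<\mu$ reaching $x_m$ and $x_{m+1}$ at its two ends, and for each interior $x_m$ at least one of $W_{m-1},W_m$ reaches $x_m$ through a $(\mu-1)$-wtip. A one-ended $\vec{\omega}$-walk is $\langle x_0,W_0,x_1,W_1,\dots\rangle$ where the $x_m$ are wnodes of strictly increasing natural ranks $\mu_m$ and $W_m$ is a $(\mu_{m+1}-1)$-walk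 reaching $x_m$ and reaching $x_{m+1}$ through a $(\mu_{m+1}-1)$-wtip; an endless one is two of these joined at the start; there are no two-ended $\vec{\omega}$-walks. **Lengths and wdistances.** A two-ended $0$-walk has length its number of branch traversals; for natural $\mu$ a one-ended (endless) $\mu$-walk has length $\omega^{\mu+1}$ ($\omega^{\mu+1}\cdot 2$); a one-ended (endless) $\vec{\omega}$-walk has length $\omega^{\omega}$ ($\omega^\omega\cdot 2$); a one-ended (endless) $\omega$-walk has length $\omega^{\omega+1}$ ($\omega^{\omega+1}\cdot2$); a two-ended $\mu$-walk with $\mu\ge1$ has as length the natural sum of the lengths of its $W_m$. The wdistance $d(x,y)$ is the minimum of the lengths of the two-ended walks terminating at $x$ and $y$ (wnodes embraced one by the other are not distinguished), with $d(x,x)=0$. A wgraph is wconnected if any two of its wnodes are joined by a two-ended walk. **Wsections.** A wsubgraph induced by a set $B_s\subset B$ consists of $B_s$, the $0$-nodes incident to it, and the $\gamma$-wnodes embracing a $(\gamma-1)$-wtip with a representative whose branches all lie in $B_s$. A $\rho$-wsection $S^\rho$ of $G^\nu$ is a maximal wsubgraph of $\{X^0,B,\dots,X^\rho\}$ that is $\rho$-wconnected, i.e. any two of its wnodes are the terminal wnodes of a two-ended $\alpha$-walk with $\alpha\le\rho$. The only $\nu$-wsection is $G^\nu$. $S^\rho$ is regarded as a $\rho$-wgraph by itself, with its own wdistance $d$. **Enlargement.** Fix a free ultrafilter $\mathcal F$ on $\mathbb N$. For a wgraph $S$, a $\gamma$-hypernode $\mathbf x=[x_n]$ of the enlargement ${}^{*}\!S$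 is an equivalence class of sequences of $\gamma$-wnodes of $S$ under equality for all $n$ in a member of $\mathcal F$; hyperbranches are the analogous classes $[b_n]$ of sequences of branches, $[\{x_n,y_n\}]$ being incident to the $0$-hypernodes $[x_n],[y_n]$. A standard hypernode is the class of a constant sequence. ${}^{*}\!S$ consists of all hypernodes and hyperbranches. **Galaxies.** For $\rho$ natural or $\rho=\omega$, hypernodes $[x_n],[y_n]$ (of any ranks) of ${}^{*}\!S^\rho$ are $\rho$-limitedly distant if there is $\mu\in\mathbb N$ with $\{n: d(x_n,y_n)\le\omega^\rho\cdot\mu\}\in\mathcal F$. This is an equivalence relation; its classes are the nodal $\rho$-galaxies, and a $\rho$-galaxy is a nodal $\rho$-galaxy together with all hyperbranches whose incident $0$-hypernodes lie in it. The principal $\rho$-galaxy $\Gamma_0^\rho$ is the one whose hypernodes are $\rho$-limitedly distant from a standard hypernode. **Closeness.** For $\rho$-galaxies $\Gamma_a^\rho,\Gamma_b^\rho$ of ${}^{*}\!S^\rho$, $\Gamma_a^\rho$ is closer to $\Gamma_0^\rho$ than is $\Gamma_b^\rho$ if there are hypernodes $\mathbf y=[y_n]$ in $\Gamma_a^\rho$ and $\mathbf z=[z_n]$ in $\Gamma_b^\rho$ such that, for some $\mathbf x=[x_n]$ in $\Gamma_0^\rho$ and for every $m_0\in\mathbb N$, $\{n: d(z_n,x_n)-d(y_n,x_n)\ge\omega^\rho\cdot m_0\}\in\mathcal F$, where the inequality means $d(z_n,x_n)\ge d(y_n,x_n)+\omega^\rho\cdot m_0$ (natural sum). (The ranks of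 these hypernodes are arbitrary ranks other than $\vec{\omega}$; the condition does not depend on the chosen representatives.) ''Partially ordered according to closeness to $\Gamma_0^\rho$'' means that the relation ''$\Gamma_a^\rho=\Gamma_b^\rho$ or $\Gamma_a^\rho$ is closer to $\Gamma_0^\rho$ than is $\Gamma_b^\rho$'' is reflexive, antisymmetric and transitive. *)

(* Defs.v *)
From HB Require Import structures.
From mathcomp Require Import all_boot all_order all_algebra.
From mathcomp Require Import boolp classical_sets filter.
From Stdlib Require Import Relation_Operators.

Set Implicit Arguments.
Unset Strict Implicit.
Unset Printing Implicit Defensive.

Import Order.TTheory GRing.Theory Num.Theory.

Local Open Scope classical_set_scope.
Local Open Scope ring_scope.

(** * Ranks: 0 < 1 < 2 < ... < arrow-omega < omega *)

Inductive rank := Fin of nat | ArrowOmega | Omega.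

Definition rle (a b : rank) : bool :=
  match a, b with
  | Fin m, Fin n => (m <= n)%N
  | Fin _, _ => true
  | ArrowOmega, Fin _ => false
  | ArrowOmega, _ => true
  | Omega, Omega => true
  | Omega, _ => false
  end.

Definition rlt (a b : rank) : bool := ~~ rle b a.

(* [rsucc a = Some b] reads "a = b - 1"; thus omega - 1 is arrow-omega, and
   neither 0 nor arrow-omega is a successor. *)
Definition rsucc (a : rank) : option rank :=
  match a with
  | Fin n => Some (Fin n.+1)
  | ArrowOmega => Some Omega
  | Omega => None
  end.

(** * Ordinals *)

(* The ordinals below omega^(omega+2), which include all lengths of walks, in
   Cantor normal form: (a, b, p) stands for
     omega^(omega+1) * a + omega^omega * b + (\sum_k omega^k * p`_k).
   The natural (Hessenberg) sum adds coefficients, so it is the addition of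
   the product nmodType, and [x *+ m] is the m-fold natural sum of x, which
   for a power x of omega is the ordinal product x * m. *)
Definition ord : Type := (nat * nat * {poly nat})%type.
HB.instance Definition _ := GRing.Nmodule.on ord.

Definition poly_lt (p q : {poly nat}) : Prop :=
  exists k, ((p`_k)%R < (q`_k)%R)%N /\ forall j, (k < j)%N -> p`_j = q`_j.

Definition olt (x y : ord) : Prop :=
  let: (a, b, p) := x in
  let: (a', b', p') := y in
  (a < a')%N \/ a = a' /\ ((b < b')%N \/ b = b' /\ poly_lt p p').

Definition ole (x y : ord) : Prop := x = y \/ olt x y.

(* omega^rho, for rho natural or omega (the value at arrow-omega is never
   used). *)
Definition omega_pow (rho : rank) : ord :=
  if rho is Fin k then (0%N, 0%N, 'X^k) else (0%N, 1%N, 0).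

(* Length of a one-ended a-walk: omega^(a+1), where arrow-omega + 1 = omega. *)
Definition one_ended_length (a : rank) : ord :=
  match a with
  | Fin k => (0%N, 0%N, 'X^(k.+1))
  | ArrowOmega => (0%N, 1%N, 0)
  | Omega => (1%N, 0%N, 0)
  end.

(** * Alternating sequences *)

(* [Walk a lo hi x h] is a candidate a-walk
     < ..., x m, h m, x (m + 1), h (m + 1), ... >
   whose nodes are indexed by the integers m with lo <= m <= hi, a bound None
   meaning that the sequence is infinite on that side.  Values of x and h at
   other indices are irrelevant, and are ignored by every notion below.
   Between consecutive nodes there is a branch or a walk. *)
Inductive walk (node : Type) : Type :=
  Walk of rank & option int & option int & (int -> node) & (int -> hop node)
with hop (node : Type) : Type :=
  | Br of set node
  | Wk of walk node.

Section Sequences.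
Variable node : Type.
Implicit Types (w v : walk node) (m : int).

Definition wrank w := let: Walk a _ _ _ _ := w in a.
Definition wlo w := let: Walk _ lo _ _ _ := w in lo.
Definition whi w := let: Walk _ _ hi _ _ := w in hi.
Definition wnode w := let: Walk _ _ _ x _ := w in x.
Definition whop w := let: Walk _ _ _ _ h := w in h.

Definition node_idx w m : bool :=
  (if wlo w is Some a then a <= m else true) &&
  (if whi w is Some b then m <= b else true).

Definition hop_idx w m : bool := node_idx w m && node_idx w (m + 1).

Definition interior_idx w m : bool := node_idx w (m - 1) && node_idx w (m + 1).

(* The reversed sequence, all subwalks being reversed too. *)
Fixpoint rev_walk w : walk node :=
  let: Walk a lo hi x h := w in
  Walk a (omap -%R hi) (omap -%R lo)
    (fun m => x (- m)) (fun m => rev_hop (h (- m - 1)))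
with rev_hop (e : hop node) : hop node :=
  match e with Br b => Br b | Wk v => Wk (rev_walk v) end.

(* The part of w that starts at its m-th node. *)
Definition tail w m : walk node :=
  Walk (wrank w) (Some m) (whi w) (wnode w) (whop w).

(* Equality of walks as sequences, i.e. up to a shift of the indices of the
   walk and of its subwalks. *)
Inductive same_walk : walk node -> walk node -> Prop :=
  SameWalk v w (k : int) :
    wrank v = wrank w ->
    (forall m, node_idx v m = node_idx w (m + k)) ->
    (forall m, node_idx v m -> wnode v m = wnode w (m + k)) ->
    (forall m, hop_idx v m -> same_hop (whop v m) (whop w (m + k))) ->
    same_walk v w
with same_hop : hop node -> hop node -> Prop :=
  | SameBr b : same_hop (Br b) (Br b)
  | SameWk v w : same_walk v w -> same_hop (Wk v) (Wk w).

(* Eventual identity (up to a shift) of walks that are infinite on the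
   right. *)
Definition eventually_identical v w : Prop :=
  exists k N : int, forall m, N <= m ->
    [/\ node_idx v m, node_idx w (m + k),
        wnode v m = wnode w (m + k) &
        same_hop (whop v m) (whop w (m + k))].

(* For a two-ended walk the length is the natural sum of the lengths of the
   W_m, a branch counting for 1. *)
Fixpoint walk_length w : ord :=
  let: Walk a lo hi x h := w in
  match lo, hi with
  | Some i, Some j => \sum_(0 <= n < `|j - i|%N) hop_length (h (i + n%:Z))
  | None, None => one_ended_length a *+ 2
  | _, _ => one_ended_length a
  end
with hop_length (e : hop node) : ord :=
  match e with Br _ => omega_pow (Fin 0) | Wk v => walk_length v end.

(* All the nodes (resp. branches) occurring in w, at any depth, are in X
   (resp. B). *)
Inductive walk_within (X : set node) (B : set (set node)) : walk node -> Prop :=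
  WalkWithin w :
    (forall m, node_idx w m -> X (wnode w m)) ->
    (forall m b, hop_idx w m -> whop w m = Br b -> B b) ->
    (forall m v, hop_idx w m -> whop w m = Wk v -> walk_within X B v) ->
    walk_within X B w.

End Sequences.

(** * Wgraphs *)

(* The data of a wgraph.  A wnode x of rank b = a + 1 is the set
   [tips x] of a-wtips together with its exceptional element [exc x], if any.
   [elems x] is the sequence of elements of an arrow-omega-wnode x, and is
   irrelevant for the other wnodes. *)
Record wdata := WData {
  node :> Type;
  rk : node -> rank;
  branch : set (set node);
  tips : node -> set (set (walk node));
  exc : node -> option node;
  elems : node -> nat -> node
}.

Section Walks.
Variable G : wdata.
Implicit Types (x y z : node G) (w v : walk (node G)).

(* A wnode embraces itself and whatever its node elements embrace (its
   exceptional element or, for an arrow-omega-wnode, the wnodes of the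
   sequence). *)
Inductive embraces : node G -> node G -> Prop :=
  | EmbRefl x : embraces x x
  | EmbExc x y z : exc x = Some y -> embraces y z -> embraces x z
  | EmbElem x n z :
      rk x = ArrowOmega -> embraces (elems x n) z -> embraces x z.

Definition embraces_tip x (t : set (walk (node G))) : Prop :=
  exists2 y, embraces x y & tips y t.

(* An infinite end is represented by the one-ended walks obtained as tails; a
   wtip is an equivalence class, so "t is the wtip of w" is membership of a
   tail of w in t.  A walk that is infinite on the left has the wtip of its
   reverse there. *)
Definition reaches_right w x : Prop :=
  if whi w is Some b then embraces x (wnode w b)
  else exists t m, [/\ embraces_tip x t, node_idx w m & t (tail w m)].

Definition reaches_left w x : Prop := reaches_right (rev_walk w) x.

(* Reaching x through an a-wtip *)
Definition reaches_right_tip a w x : Prop :=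
  [/\ wrank w = a, whi w = None & reaches_right w x].

Definition reaches_left_tip a w x : Prop :=
  [/\ wrank w = a, wlo w = None & reaches_left w x].

Definition walk0_spec w : Prop :=
  (forall m, node_idx w m -> rk (wnode w m) = Fin 0) /\
  (forall m, hop_idx w m -> exists2 b, branch b &
     whop w m = Br b /\ b = [set wnode w m; wnode w (m + 1)]).

(* mu = a + 1 *)
Definition walkS_spec (a mu : rank) w : Prop :=
  [/\ forall m, node_idx w m -> rle (rk (wnode w m)) mu,
      forall m, interior_idx w m -> rk (wnode w m) = mu,
      forall m, hop_idx w m -> exists v,
        [/\ whop w m = Wk v, rlt (wrank v) mu,
            reaches_left v (wnode w m) &
            reaches_right v (wnode w (m + 1))] &
      forall m, interior_idx w m ->
        (exists2 v, whop w (m - 1) = Wk v & reaches_right_tip a v (wnode w m))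
        \/
        (exists2 v, whop w m = Wk v & reaches_left_tip a v (wnode w m))].

(* c is the index of the start x_0: the ranks increase from x_0 towards every
   infinite end. *)
Definition walkV_spec w : Prop :=
  exists c : int,
  [/\ node_idx w c,
      ~~ (wlo w && whi w),
      (if wlo w is Some i then i = c else True) /\
      (if whi w is Some j then j = c else True),
      forall m, hop_idx w m -> c <= m ->
        exists v r s, [/\ whop w m = Wk v, wrank v = Fin s,
          rk (wnode w m) = Fin r /\ rk (wnode w (m + 1)) = Fin s.+1,
          (r < s.+1)%N &
          reaches_left v (wnode w m) /\
          reaches_right_tip (Fin s) v (wnode w (m + 1))] &
      forall m, hop_idx w m -> m < c ->
        exists v r s, [/\ whop w m = Wk v, wrank v = Fin s,
          rk (wnode w (m + 1)) = Fin r /\ rk (wnode w m) = Fin s.+1,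
          (r < s.+1)%N &
          reaches_right v (wnode w (m + 1)) /\
          reaches_left_tip (Fin s) v (wnode w m)]].

Definition walk_spec w : Prop :=
  match wrank w with
  | Fin 0 => walk0_spec w
  | Fin k.+1 => walkS_spec (Fin k) (Fin k.+1) w
  | ArrowOmega => walkV_spec w
  | Omega => walkS_spec ArrowOmega Omega w
  end.

(* (Nontrivial) walks of G *)
Inductive is_walk : walk (node G) -> Prop :=
  IsWalk w :
    (exists m, hop_idx w m) ->
    walk_spec w ->
    (forall m v, hop_idx w m -> whop w m = Wk v -> is_walk v) ->
    is_walk w.

Definition one_ended (a : rank) w : Prop :=
  [/\ is_walk w, wrank w = a, isSome (wlo w) & whi w = None].

(* t is an a-wtip of G *)
Definition wtip (a : rank) (t : set (walk (node G))) : Prop :=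
  exists2 w, one_ended a w &
    t = [set v | one_ended a v /\ eventually_identical v w].

End Walks.

(* G is a wgraph of rank nu.  The wtips in the [tips x], for x of rank
   b = a + 1 <= nu, partition the set of all a-wtips into nonempty sets. *)
Record wgraph (nu : rank) (G : wdata) : Prop := WGraph {
  wg_rank : forall x : node G, rle (rk x) nu;
  wg_nonempty : forall a, rle a nu -> a <> ArrowOmega ->
    exists x : node G, rk x = a;
  wg_branch : forall b : set (node G), branch b ->
    exists x y, [/\ x <> y, rk x = Fin 0, rk y = Fin 0 & b = [set x; y]];
  wg_tips_none : forall x : node G, rk x = Fin 0 \/ rk x = ArrowOmega ->
    tips x = set0 /\ exc x = None;
  wg_tips_nonempty : forall a b (x : node G), rsucc a = Some b -> rk x = b ->
    tips x !=set0 /\ forall t, tips x t -> wtip a t;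
  wg_tips_partition : forall a b t, rsucc a = Some b -> rle b nu ->
    wtip (G := G) a t -> exists! x : node G, rk x = b /\ tips x t;
  wg_exc_rank : forall x y : node G, exc x = Some y -> rlt (rk y) (rk x);
  wg_exc_inj : forall x x' y : node G,
    exc x = Some y -> exc x' = Some y -> x = x';
  wg_elems : forall x : node G, rk x = ArrowOmega -> forall n, exists r s,
    [/\ rk (elems x n) = Fin r, rk (elems x n.+1) = Fin s, (r < s)%N &
        embraces (elems x n.+1) (elems x n)];
  wg_elems_inj : forall x y : node G, rk x = ArrowOmega -> rk y = ArrowOmega ->
    (forall n, elems x n = elems y n) -> x = y
}.

(** * Wsubgraphs, wdistances, wsections *)

Record wsubgraph (G : wdata) := WSub {
  snode : set (node G);
  sbranch : set (set (node G))
}.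

Section Distances.
Variable G : wdata.
Implicit Types (S : wsubgraph G) (x y : node G) (w : walk (node G)).

Definition whole : wsubgraph G := WSub setT (@branch G).

(* The wsubgraph of {X^0, B, ..., X^rho} induced by the branch set Bs.  No
   clause is needed for arrow-omega-wnodes: this is only used with rho a
   natural rank. *)
Definition induced (rho : rank) (Bs : set (set (node G))) : wsubgraph G :=
  WSub [set x | rle (rk x) rho /\
     ((rk x = Fin 0 /\ exists2 b, Bs b & b x) \/
      (exists a t w, [/\ rsucc a = Some (rk x), wtip a t, embraces_tip x t,
         t w & walk_within setT Bs w]))] Bs.

(* The two-ended walks of rank at most rho in S *)
Definition two_ended_in (rho : rank) S w : Prop :=
  [/\ is_walk w, rle (wrank w) rho, wlo w && whi w &
      walk_within (snode S) (sbranch S) w].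

Definition terminals w x y : Prop :=
  exists i j, [/\ wlo w = Some i, whi w = Some j,
                  wnode w i = x & wnode w j = y].

(* Wnodes embraced one by the other are not distinguished. *)
Definition indist : node G -> node G -> Prop :=
  clos_refl_sym_trans (node G) (@embraces G).

Definition joins w x y : Prop :=
  exists x' y', [/\ indist x x', indist y y' & terminals w x' y'].

Definition wdist_set (rho : rank) S x y : set ord :=
  [set l | (indist x y /\ l = 0) \/
           (exists w, [/\ two_ended_in rho S w, joins w x y &
                          l = walk_length w])].

(* The wdistance in S, regarded as a rho-wgraph: the least element of
   [wdist_set rho S x y] (and 0, by convention, when that set is empty, i.e.
   when x and y are not joined by a walk) *)
Definition wdist (rho : rank) S x y : ord :=
  xget 0 [set l | wdist_set rho S x y l /\
                  forall l', wdist_set rho S x y l' -> ole l l'].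

(* Connectedness of a whole wgraph of rank nu *)
Definition wconnected (nu : rank) : Prop :=
  forall x y : node G, ~ indist x y ->
    exists2 w, two_ended_in nu whole w & joins w x y.

Definition rho_wconnected (rho : rank) S : Prop :=
  forall x y, snode S x -> snode S y -> x <> y ->
    exists2 w, two_ended_in rho S w & terminals w x y.

(* S is a rho-wsection of the wgraph G of rank nu; the only nu-wsection is G
   itself.  A wsubgraph being determined by its branch set, maximality is
   expressed on branch sets. *)
Definition wsection (nu rho : rank) S : Prop :=
  (rho = nu /\ S = whole) \/
  (rlt rho nu /\
   exists2 Bs : set (set (node G)), Bs `<=` @branch G &
     [/\ S = induced rho Bs,
         rho_wconnected rho S &
         forall Bs', Bs' `<=` @branch G -> Bs `<=` Bs' ->
           rho_wconnected rho (induced rho Bs') -> Bs' = Bs]).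

End Distances.

(** * Enlargements and galaxies *)

Definition free_ultrafilter (F : set_system nat) : Prop :=
  UltraFilter F /\ \bigcap_(A in F) A = set0.

Section Enlargement.
Variables (F : set_system nat) (G : wdata) (rho : rank) (S : wsubgraph G).

Local Notation NodeSeq := (nat -> node G).
Local Notation BranchSeq := (nat -> set (node G)).
Local Notation d := (wdist rho S).

Definition node_seq (g : rank) (x : NodeSeq) : Prop :=
  forall n, snode S (x n) /\ rk (x n) = g.

Definition node_class (g : rank) (x : NodeSeq) : set NodeSeq :=
  [set y | node_seq g y /\ F [set n | x n = y n]].

(* h is a g-hypernode of the enlargement of S. *)
Definition hypernode (g : rank) (h : set NodeSeq) : Prop :=
  exists2 x, node_seq g x & h = node_class g x.

Definition is_hypernode (h : set NodeSeq) : Prop := exists g, hypernode g h.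

Definition standard (h : set NodeSeq) : Prop :=
  exists2 x, snode S x & h = node_class (rk x) (fun=> x).

Definition hyperbranch (c : set BranchSeq) : Prop :=
  exists2 b : BranchSeq, forall n, sbranch S (b n) &
    c = [set b' | (forall n, sbranch S (b' n)) /\ F [set n | b n = b' n]].

(* The 0-hypernode h is incident to the hyperbranch c. *)
Definition incident (c : set BranchSeq) (h : set NodeSeq) : Prop :=
  hypernode (Fin 0) h /\ exists b x, [/\ c b, h x & forall n, b n (x n)].

Definition limitedly_distant (h k : set NodeSeq) : Prop :=
  exists x y, [/\ h x, k y &
    exists mu : nat, F [set n | ole (d (x n) (y n)) (omega_pow rho *+ mu)]].

Record hypersubgraph := HyperSub {
  hnodes : set (set NodeSeq);
  hbranches : set (set BranchSeq)
}.

Definition with_hyperbranches (P : set (set NodeSeq)) : hypersubgraph :=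
  HyperSub P [set c | hyperbranch c /\ forall h, incident c h -> P h].

Definition nodal_galaxy (P : set (set NodeSeq)) : Prop :=
  exists2 h, is_hypernode h &
    P = [set k | is_hypernode k /\ limitedly_distant h k].

Definition galaxy (Ga : hypersubgraph) : Prop :=
  exists2 P, nodal_galaxy P & Ga = with_hyperbranches P.

Definition principal_galaxy : hypersubgraph :=
  with_hyperbranches [set h | is_hypernode h /\
    exists2 s, standard s & limitedly_distant s h].

(* Ga is closer to the principal galaxy than is Gb; the witnesses may have any
   ranks except arrow-omega. *)
Definition closer (Ga Gb : hypersubgraph) : Prop :=
  exists gy gz gx hy hz hx y z x,
    [/\ [/\ gy <> ArrowOmega, gz <> ArrowOmega & gx <> ArrowOmega],
        [/\ hypernode gy hy, hypernode gz hz & hypernode gx hx],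
        [/\ hnodes Ga hy, hnodes Gb hz & hnodes principal_galaxy hx],
        [/\ hy y, hz z & hx x] &
        forall m0 : nat,
          F [set n | ole (d (y n) (x n) + omega_pow rho *+ m0)
                         (d (z n) (x n))]].

End Enlargement.

(* R is a partial order on the set A. *)
Definition partial_order_on (T : Type) (A : set T) (R : T -> T -> Prop) : Prop :=
  [/\ forall a, A a -> R a a,
      forall a b, A a -> A b -> R a b -> R b a -> a = b &
      forall a b c, A a -> A b -> A c -> R a b -> R b c -> R a c].

(* Main.v *)
Require Import Defs.
From mathcomp Require Import all_boot all_order all_algebra.
From mathcomp Require Import boolp classical_sets filter.
From mathcomp Require Import zify.
From Stdlib Require Import Relation_Operators.

(** Closeness only sees wdistances up to finite multiples of omega^rho, so the
theorem needs a wdistance with three coarse properties: it is symmetric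
([wdist_sym]), it is at most a finite multiple of omega^rho between two fixed
wnodes of the wsection ([wdist_bounded]), and it satisfies the triangle
inequality up to an error omega^rho * 2 ([wdist_triangle]).  Given these,
replacing a hypernode of a galaxy, or the base hypernode in the principal
galaxy, by another one changes wdistances by at most some omega^rho * N on a set of the
ultrafilter.  Natural sums are cancellative, so gaps that exceed every multiple
of omega^rho survive such changes: closeness is transitive ([closer_trans]).
No galaxy is closer than itself ([closer_irr]), since its own hypernodes are
limitedly distant; antisymmetry follows.

The substance is the triangle inequality: two walks that meet at
indistinguishable wnodes have to be turned into one walk
([two_ended_concat]).  Juxtaposition does not do, because an interior wnode of
a mu-walk must have rank mu and be reached through a (mu-1)-wtip by one of the
two adjacent subwalks.  If one of the two subwalks that meet does so, the
walks are juxtaposed.  Otherwise both subwalks end, in the generalized sense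
of [end_right], at wnodes of rank below mu; these are embraced by a common
wnode, hence one of them embraces the other ([embraces_down]), and by
induction on the rank the two subwalks are merged into a single one
([join_fin]).  Apart from subwalks of the two given walks, the resulting one
has a single subwalk, whose length is at most omega^mu * 2 because its rank is below mu
([walk_length_bound]): this is the error term.

For rho = omega two further things happen.  An arrow-omega-walk has no
natural rank to which the induction applies, but a walk that arrives at its
start can be absorbed, with any initial part of it, in a single subwalk of
large natural rank ([fwd_prefix], [joinable_arrow]).  And two different
omega-wnodes may be indistinguishable, because their exceptional elements can
be different arrow-omega-wnodes that run through the same chain
([indist_Omega_common]).  They then embrace a common wnode of positive natural
rank, and an endless walk of natural rank that leaves this wnode through a
wtip and returns through it ([loop_at]) is inserted between them; its length
again disappears in the error term. *)

Set Implicit Arguments.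
Unset Strict Implicit.
Unset Printing Implicit Defensive.

Import Order.TTheory GRing.Theory Num.Theory.

Local Open Scope classical_set_scope.
Local Open Scope ring_scope.

(** * Ordinals and natural sums *)

Lemma poly_lt_irr p : ~ poly_lt p p.
Proof. by case=> k []; rewrite ltnn. Qed.

Lemma poly_lt_trans q p r : poly_lt p q -> poly_lt q r -> poly_lt p r.
Proof.
move=> [k [pk hk]] [l [ql hl]].
have [lt_kl|lt_lk|eq_kl] := ltngtP k l.
- exists l; split=> [|j lj]; first by rewrite hk.
  by rewrite hk ?hl // (ltn_trans lt_kl).
- exists k; split=> [|j kj]; first by rewrite -hl.
  by rewrite hk // hl // (ltn_trans lt_lk).
- subst l; exists k; split=> [|j kj]; first exact: ltn_trans ql.
  by rewrite hk // hl.
Qed.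

Lemma poly_lt_total p q : [\/ poly_lt p q, p = q | poly_lt q p].
Proof.
have [->|npq] := eqVneq p q; first by constructor 2.
have exP : exists k, p`_k != q`_k.
  apply/not_existsP => h; case/eqP: npq; apply/polyP => i.
  by apply/eqP; apply/negPn/negP/h.
have ubP k : p`_k != q`_k -> (k <= maxn (size p) (size q))%N.
  apply: contraNT; rewrite -ltnNge gtn_max => /andP[hp hq].
  by rewrite !nth_default // ltnW.
have [k pqk kmax] := ex_maxnP exP ubP.
have hk j : (k < j)%N -> p`_j = q`_j.
  by move=> kj; apply/eqP; apply: contraTT kj => /kmax; rewrite -leqNgt.
case: (ltngtP (p`_k)%R (q`_k)%R) pqk => // lt_pq _; [constructor 1|constructor 3].
  by exists k.
by exists k; split=> // j /hk.
Qed.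

Lemma poly_lt_add r p q : poly_lt p q -> poly_lt (p + r) (q + r).
Proof.
move=> [k [pk hk]]; exists k; split=> [|j kj]; rewrite !coefD; last by rewrite hk.
by move: pk; set a := p`_k; set b := q`_k; set c := r`_k; lia.
Qed.

(** Once an element of [A] is given, only finitely many coefficients of a
smaller one can be nonzero; they are minimized in turn, from the highest
down, among the elements that agree above. *)
Lemma poly_min (A : set {poly nat}) : A !=set0 ->
  exists2 p, A p & forall q, A q -> p = q \/ poly_lt p q.
Proof.
have agree_min n : forall B : set {poly nat}, B !=set0 ->
    (forall p q j, B p -> B q -> (n <= j)%N -> p`_j = q`_j) ->
    exists2 p, B p & forall q, B q -> p = q \/ poly_lt p q.
  elim: n => [|n IHn] B [p0 Bp0] agr.
    by exists p0 => // q Bq; left; apply/polyP => j; apply: agr.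
  have exP : exists k, `[< exists2 p, B p & p`_n = k >].
    by exists p0`_n; apply/asboolP; exists p0.
  have [k /asboolP[p1 Bp1 p1n] kmin] := ex_minnP exP.
  have [|p q j [Bp pn] [Bq qn]|p [Bp pn] pmin] := IHn (B `&` [set p | p`_n = k]).
  - by exists p1.
  - rewrite leq_eqVlt => /orP[/eqP <-|nj]; first by rewrite pn qn.
    exact: agr.
  exists p => // q Bq; have [qn|qn] := eqVneq (q`_n)%R k; first exact: pmin.
  right; exists n; split=> [|j nj]; last exact: agr.
  rewrite pn ltn_neqAle eq_sym qn kmin //; apply/asboolP; by exists q.
move=> [p0 Ap0].
have [|p q j [_ /= sp] [_ /= sq] sj|p [Ap sp] pmin] :=
  agree_min (size p0) (A `&` [set p | (size p <= size p0)%N]).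
- by exists p0; split=> /=.
- by rewrite !nth_default // (leq_trans _ sj).
exists p => // q Aq; have [sq|sq] := leqP (size q) (size p0); first exact: pmin.
have q0 : (0 < size q)%N by apply: leq_ltn_trans sq.
rewrite /= in sp; have sp' := leq_trans sp (_ : size p0 <= (size q).-1)%N.
have {}sp' : (size p <= (size q).-1)%N by apply: sp'; rewrite -ltnS prednK.
right; exists (size q).-1; split=> [|j sj].
  by rewrite [X in (X < _)%N]nth_default // lt0n -/(lead_coef q) lead_coef_eq0 -size_poly_gt0.
by rewrite !nth_default //; [rewrite -(prednK q0) | apply: leq_trans sp' (ltnW sj)].
Qed.

Lemma ord_addE (x y : ord) :
  x + y = ((x.1.1 + y.1.1)%N, (x.1.2 + y.1.2)%N, x.2 + y.2).
Proof. by []. Qed.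

Lemma olt_irr x : ~ olt x x.
Proof.
case: x => [[a b] p] /=; rewrite !ltnn => -[|[_ [|[_]]]] //; exact: poly_lt_irr.
Qed.

Lemma olt_trans y x z : olt x y -> olt y z -> olt x z.
Proof.
case: x y z => [[a b] p] [[a' b'] p'] [[a'' b''] p''] /=.
case=> [h1|[-> [h1|[-> h1]]]] [h2|[<- [h2|[<- h2]]]];
 by [left; lia | right; split => //; left; lia
    | right; split => //; right; split=> //; apply: poly_lt_trans h2].
Qed.

Lemma olt_total x y : [\/ olt x y, x = y | olt y x].
Proof.
case: x y => [[a b] p] [[a' b'] p'] /=.
have [h|h|<-] := ltngtP a a'; [by constructor 1; left | by constructor 3; left |].
have [h|h|<-] := ltngtP b b';
  [by constructor 1; right; split=> //; left | by constructor 3; right; split => //; left |].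
have [h|<-|h] := poly_lt_total p p'.
- by constructor 1; right; split=> //; right.
- by constructor 2.
- by constructor 3; right; split=> //; right.
Qed.

Lemma olt_add z x y : olt x y -> olt (x + z) (y + z).
Proof.
rewrite !ord_addE; case: x y z => [[a b] p] [[a' b'] p'] [[a'' b''] p''] /=.
case=> [h|[-> [h|[-> h]]]]; [left; lia | right; split=> //; left; lia |].
by right; split=> //; right; split=> //; apply: poly_lt_add.
Qed.

Lemma ole_refl x : ole x x. Proof. by left. Qed.
#[local] Hint Resolve ole_refl : core.

Lemma ole_trans y x z : ole x y -> ole y z -> ole x z.
Proof.
move=> [->//|xy] [<-|yz]; first by right.
by right; apply: olt_trans yz.
Qed.

Lemma ole_olt_false x y : ole x y -> olt y x -> False.
Proof. by move=> [->|xy] yx; [case: (olt_irr yx) | case: (olt_irr (olt_trans xy yx))]. Qed.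

Lemma ole_add2r z x y : ole x y -> ole (x + z) (y + z).
Proof. by move=> [->//|xy]; right; apply: olt_add. Qed.

Lemma ole_add x y x' y' : ole x x' -> ole y y' -> ole (x + y) (x' + y').
Proof.
move=> hx hy; apply: (ole_trans (ole_add2r y hx)).
by rewrite addrC [x' + _]addrC; apply: ole_add2r.
Qed.

(** This is what makes differences of wdistances meaningful: the order is
total and natural sums are strictly monotone. *)
Lemma ole_cancel z x y : ole (x + z) (y + z) -> ole x y.
Proof.
have [h _|-> //|/olt_add h /ole_olt_false] := olt_total x y; first by right.
by move=> /(_ (h z)).
Qed.

Lemma ole0 x : ole 0 x.
Proof.
have [h|<-//|] := olt_total 0 x; first by right.
case: x => [[a b] p]; case=> [|[_ [|[_ [k [+ _]]]]]] //.
by rewrite coef0.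
Qed.

Lemma ole_addr x y : ole x (x + y).
Proof. by rewrite -{1}[x]addr0; apply: ole_add => //; apply: ole0. Qed.

Lemma ole_addl x y : ole x (y + x).
Proof. by rewrite addrC; apply: ole_addr. Qed.

(** Errors that are multiples of a fixed ordinal add up along a chain of
inequalities. *)
Lemma ole_slack_trans (e x y z : ord) m n :
  ole x (y + e *+ m) -> ole y (z + e *+ n) -> ole x (z + e *+ (n + m)).
Proof.
move=> xy yz; apply: ole_trans xy _; rewrite mulrnDr addrA.
exact: ole_add2r.
Qed.

Lemma ord_min (A : set ord) : A !=set0 ->
  exists2 x, A x & forall y, A y -> ole x y.
Proof.
move=> [[[a0 b0] p0] A0].
have exa : exists a, `[< exists b p, A (a, b, p) >].
  by exists a0; apply/asboolP; exists b0, p0.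
have [a /asboolP[b1 [p1 A1]] amin] := ex_minnP exa.
have exb : exists b, `[< exists p, A (a, b, p) >].
  by exists b1; apply/asboolP; exists p1.
have [b /asboolP[p2 A2] bmin] := ex_minnP exb.
have [|p Ap pmin] := @poly_min [set p | A (a, b, p)]; first by exists p2.
exists (a, b, p) => // -[[a' b'] p'] A'.
have : (a <= a')%N by apply: amin; apply/asboolP; exists b', p'.
rewrite leq_eqVlt => /orP[/eqP ea|lta]; last by right; left.
subst a'.
have : (b <= b')%N by apply: bmin; apply/asboolP; exists p'.
rewrite leq_eqVlt => /orP[/eqP eb|ltb]; last by right; right; split=> //; left.
subst b'.
have [->|h] := pmin _ A'; first by left.
by right; right; split=> //; right.
Qed.

Lemma ord_mulrnE (x : ord) n : x *+ n = ((x.1.1 * n)%N, (x.1.2 * n)%N, x.2 *+ n).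
Proof.
elim: n => [|n IHn]; first by rewrite !muln0 !mulr0n.
by rewrite !mulrS IHn ord_addE /= !mulnS.
Qed.

Lemma ole_poly_deg k (p : {poly nat}) a b : (size p <= k)%N ->
  ole (a, b, p) (a, b, 'X^k).
Proof.
move=> sp; right=> /=; right; split=> //; right; split=> //.
exists k; rewrite coefXn eqxx nth_default //; split=> // j kj.
by rewrite coefXn gtn_eqF // nth_default // ltnW // (leq_ltn_trans sp).
Qed.

Lemma omega_pow_mulrn_le (c mu : rank) n : c <> ArrowOmega -> mu <> ArrowOmega ->
  rlt c mu -> ole (omega_pow c *+ n) (omega_pow mu).
Proof.
case: c => [c| |] //; case: mu => [m| |] // _ _ cm; rewrite ord_mulrnE /=.
  rewrite mul0n; apply: ole_poly_deg.
  apply: leq_trans (_ : (c.+1 <= m)%N); last by move: cm; rewrite /rlt /= -ltnNge.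
  apply/leq_sizeP => j cj; rewrite coefMn coefXn gtn_eqF //.
  by rewrite mul0rn.
by right; right; split=> //; left; rewrite mul0n.
Qed.

Lemma one_ended_length_le c mu : mu <> ArrowOmega -> rlt c mu ->
  ole (one_ended_length c) (omega_pow mu).
Proof.
case: c => [c| |]; case: mu => [m| |] //= _ cm.
  have : (c.+1 <= m)%N by move: cm; rewrite /rlt /= -ltnNge.
  rewrite leq_eqVlt => /orP[/eqP ->//|cm'].
  by apply: ole_poly_deg; rewrite size_polyXn.
by right; right; split=> //; left.
Qed.

Lemma omega_pow_gt0 mu : olt 0 (omega_pow mu).
Proof.
have h : olt 0 (0%N, 1%N, 0) by right; split=> //; left.
case: mu => [m| |] //; right; split=> //; right; split=> //.
exists m; rewrite coef0 coefXn eqxx; split=> // j mj.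
by rewrite coef0 coefXn gtn_eqF.
Qed.

(** * Ranks and the embracing relation *)

Lemma rle_refl a : rle a a. Proof. by case: a => //= n. Qed.
#[local] Hint Resolve rle_refl : core.

Lemma rle_trans b a c : rle a b -> rle b c -> rle a c.
Proof. by case: a b c => [a| |] [b| |] [c| |] //=; apply: leq_trans. Qed.

Lemma rle_rlt_trans b a c : rle a b -> rlt b c -> rlt a c.
Proof. by rewrite /rlt => ab bc; apply: contra bc => ca; apply: rle_trans ca ab. Qed.

Lemma rltW a b : rlt a b -> rle a b.
Proof. by rewrite /rlt; case: a b => [a| |] [b| |] //=; rewrite -ltnNge => /ltnW. Qed.

Lemma rlt_irr a : rlt a a = false. Proof. by rewrite /rlt rle_refl. Qed.

Lemma rle_eqVlt a b : rle a b -> a = b \/ rlt a b.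
Proof.
rewrite /rlt; case: a b => [a| |] [b| |] //=; try by [left | right].
by rewrite leq_eqVlt -ltnNge => /orP[/eqP ->|]; [left | right].
Qed.

Lemma rltS a b : rsucc a = Some b -> rlt a b.
Proof. by case: a => [a| |] //= [<-]; rewrite /rlt /= ?ltnn. Qed.

Lemma rltS_le a b c : rsucc a = Some b -> rlt c b -> rle c a.
Proof.
case: a => [a| |] //= [<-]; rewrite /rlt; case: c => [c| |] //=.
by rewrite -ltnNge.
Qed.

Lemma rleS_lt a b c : rsucc a = Some b -> rle c a -> rlt c b.
Proof. by move=> /rltS ab ca; apply: rle_rlt_trans ab. Qed.

Section Embracing.
Variables (nu : rank) (G : wdata).
Hypothesis hG : wgraph nu G.
Implicit Types x y z p q : node G.

Lemma embraces_trans y x z : embraces x y -> embraces y z -> embraces x z.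
Proof.
move=> xy yz; elim: xy yz => [//|{}x y' y'' e _ IH yz|{}x n y' e _ IH yz].
  exact: EmbExc e (IH yz).
exact: EmbElem e (IH yz).
Qed.

Lemma embraces_inv q y : embraces q y ->
  [\/ q = y, exists2 z, exc q = Some z & embraces z y |
      rk q = ArrowOmega /\ exists n, embraces (elems q n) y].
Proof.
case=> {q y} [x|q z y e h|q n y e h]; [by constructor 1| |].
  by constructor 2; exists z.
by constructor 3; split=> //; exists n.
Qed.

Lemma elems_fin x n : rk x = ArrowOmega -> exists r, rk (elems x n) = Fin r.
Proof. by move=> e; have [r [s [h _ _ _]]] := wg_elems hG e n; exists r. Qed.

Lemma elems_rank x n : rk x = ArrowOmega ->
  exists2 r, rk (elems x n) = Fin r & (n <= r)%N.
Proof.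
move=> e; elim: n => [|n [r hr nr]].
  by have [r [s [h _ _ _]]] := wg_elems hG e 0; exists r.
have [r' [s [h1 h2 rs _]]] := wg_elems hG e n.
by exists s => //; move: h1; rewrite hr => -[rr']; apply: leq_ltn_trans nr _; rewrite rr'.
Qed.

Lemma elems_embraces x m n : rk x = ArrowOmega -> (m <= n)%N ->
  embraces (elems x n) (elems x m).
Proof.
move=> e; elim: n => [|n IHn]; first by rewrite leqn0 => /eqP ->; constructor.
rewrite leq_eqVlt => /orP[/eqP ->|/IHn h]; first by constructor.
by have [r [s [_ _ _ h']]] := wg_elems hG e n; apply: embraces_trans h.
Qed.

Lemma embraces_rank x y : embraces x y -> x = y \/ rlt (rk y) (rk x).
Proof.
elim=> [{}x|{}x z {}y e _ IH|{}x n {}y e _ IH]; first by left.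
  have := wg_exc_rank hG e; case: IH => [<-|h] h'; first by right.
  by right; apply: rle_rlt_trans (rltW h) h'.
right; have [r hr] := elems_fin n e.
have h' : rlt (rk (elems x n)) (rk x) by rewrite hr e.
by case: IH => [<-//|h]; apply: rle_rlt_trans (rltW h) h'.
Qed.

Lemma embraces_rle x y : embraces x y -> rle (rk y) (rk x).
Proof. by case/embraces_rank=> [->//|/rltW]. Qed.

Lemma embraces_eq x y : embraces x y -> rle (rk x) (rk y) -> x = y.
Proof. by case/embraces_rank=> // /negP. Qed.

Lemma embraces_fin x y r : rk x = Fin r -> embraces x y ->
  exists2 s, rk y = Fin s & (s <= r)%N.
Proof.
by move=> e /embraces_rle; rewrite e; case: (rk y) => // s ?; exists s.
Qed.

Lemma embraces_parent_fin (b c y : node G) r : rk c = Fin r ->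
  exc b = Some y -> embraces c y -> c <> y -> embraces c b.
Proof.
move=> rc eb cy; elim: cy r rc eb => [{}c //|{}c z {}y ec zy IH r rc eb cy|{}c n {}y ec _ _ r].
  have [zy'|nzy] := pselect (z = y).
    by subst z; rewrite (wg_exc_inj hG eb ec); constructor.
  have [s rz _] := embraces_fin rc (EmbExc ec (EmbRefl z)).
  by apply: EmbExc ec (IH s rz eb nzy).
by rewrite ec.
Qed.

(** The chain of exceptional elements that leads from [c] down to [y] can only
enter [y] from [b], as [y] is the exceptional element of no other wnode. *)
Lemma embraces_parent (b c y : node G) :
  exc b = Some y -> embraces c y -> c <> y -> embraces c b.
Proof.
move=> eb cy; elim: cy eb => [{}c //|{}c z {}y ec zy IH eb cy|{}c n {}y ec ny IH eb _].
  have [zy'|nzy] := pselect (z = y); last by apply: EmbExc ec (IH eb nzy).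
  by subst z; rewrite (wg_exc_inj hG eb ec); constructor.
have [ny'|nny] := pselect (elems c n = y); last by apply: EmbElem ec (IH eb nny).
subst y; have [r [s [h1 h2 rs h]]] := wg_elems hG ec n.
apply: (EmbElem (n := n.+1)) ec _; apply: (embraces_parent_fin h2 eb h).
by move=> h'; move: h2; rewrite h' h1 => -[h2]; move: rs; rewrite h2 ltnn.
Qed.

Lemma embraces_down_fin q x y r : rk q = Fin r ->
  embraces q x -> embraces q y -> embraces x y \/ embraces y x.
Proof.
move=> + qx; elim: qx y r => {q x} [x y r _|q z x eq zx IH y r rq|q n x eq _ _ y r].
- by left.
- move=> /embraces_inv[<-|[z' eq' z'y]|[eq' _]]; first by right; apply: EmbExc eq zx.
    have [s rz _] := embraces_fin rq (EmbExc eq (EmbRefl z)).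
    by move: eq'; rewrite eq => -[eq']; subst z'; apply: IH rz z'y.
  by rewrite eq' in rq.
- by rewrite eq.
Qed.

Lemma exc_notV x y : rk x = ArrowOmega -> exc x = Some y -> False.
Proof. by move=> rx; have [_ ->] := wg_tips_none hG (or_intror rx). Qed.

(** Below a wnode of natural rank or of rank omega the embraced wnodes form the
chain of successive exceptional elements; below an arrow-omega-wnode any two of
them lie under a common member of the sequence. *)
Lemma embraces_down q x y : embraces q x -> embraces q y ->
  embraces x y \/ embraces y x.
Proof.
move=> qx; elim: qx y => {q x} [x y|q z x eq zx IH y|q n x eq nx IH y].
- by left.
- move=> /embraces_inv[<-|[z' eq' z'y]|[eq' _]]; first by right; apply: EmbExc eq zx.
    by move: eq'; rewrite eq => -[eq']; subst z'; apply: IH.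
  by case: (exc_notV eq' eq).
- move=> /embraces_inv[<-|[z' eq' z'y]|[_ [m my]]].
  + by right; apply: EmbElem eq nx.
  + by case: (exc_notV eq eq').
  + have [r hr] := elems_fin (maxn n m) eq.
    apply: (embraces_down_fin hr).
      by apply: embraces_trans nx; apply: elems_embraces eq (leq_maxl _ _).
    by apply: embraces_trans my; apply: elems_embraces eq (leq_maxr _ _).
Qed.

(** Upwards the chain does not branch as long as it stays in the natural ranks;
the rank of [c] is arbitrary, which is what allows the comparison with
omega-wnodes. *)
Lemma embraces_up (a b c : node G) r : rk b = Fin r -> embraces b a -> embraces c a ->
  embraces b c \/ embraces c b.
Proof.
move=> + ba; elim: ba c r => {b a} [b c r _ |b y a eb ya IH c r rb ca|b n a eb _ _ c r].
- by right.
- have [s ry _] := embraces_fin rb (EmbExc eb (EmbRefl y)).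
  have [yc|cy] := IH c s ry ca; first by left; apply: EmbExc eb yc.
  have [->|ncy] := pselect (c = y); first by left; apply: EmbExc eb (EmbRefl y).
  by right; apply: embraces_parent eb cy ncy.
- by rewrite eb.
Qed.

(** Sharing an embraced wnode of natural rank is a transitive relation, by
[embraces_down]; so the equivalence closure of embracing reduces to it. *)
Lemma indist_common x y : indist x y ->
  x = y \/ exists p r, [/\ rk p = Fin r, embraces x p & embraces y p].
Proof.
elim=> {x y} [x y xy|x|x y _ [->|[p [r [rp xp yp]]]]|x y z _ xy _ yz].
- have [->|lt_yx] := embraces_rank xy; first by left.
  right; move: lt_yx xy; case ry: (rk y) => [r| |] lt_yx xy.
  + by exists y, r; split=> //; constructor.
  + have [r hr] := elems_fin 0 ry.
    have yp : embraces y (elems y 0) by apply: EmbElem ry (EmbRefl _).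
    by exists (elems y 0), r; split=> //; apply: embraces_trans yp.
  + by case: (rk x) lt_yx.
- by left.
- by left.
- by right; exists p, r.
- case: xy => [->//|[p [r [rp xp yp]]]]; case: yz => [<-|[p' [r' [rp' yp' zp']]]].
    by right; exists p, r.
  right; have [pp'|p'p] := embraces_down yp yp'.
    by exists p', r'; split=> //; apply: embraces_trans pp'.
  by exists p, r; split=> //; apply: embraces_trans p'p.
Qed.

Lemma indist_sym x y : indist x y -> indist y x.
Proof. exact: rst_sym. Qed.

Lemma indist_trans y x z : indist x y -> indist y z -> indist x z.
Proof. exact: rst_trans. Qed.

Lemma indist_fin_comparable x y r s : rk x = Fin r -> rk y = Fin s ->
  indist x y -> embraces x y \/ embraces y x.
Proof.
move=> rx _ /indist_common[->|[p [t [_ xp yp]]]]; first by left; constructor.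
exact: embraces_up rx xp yp.
Qed.

Lemma indist_Omega_embraces x y r : rk x = Fin r -> rk y = Omega ->
  indist x y -> embraces y x.
Proof.
move=> rx ry /indist_common[xy|[p [t [_ xp yp]]]]; first by rewrite -xy rx in ry.
have [/embraces_rle|//] := embraces_up rx xp yp.
by rewrite rx ry.
Qed.

(** If the exceptional element of [x] had natural rank then [y], which lies
above it, would embrace [x] by [embraces_parent].  So it is an
arrow-omega-wnode; its members have unbounded natural ranks, and [embraces_up]
puts them below [y] as well. *)
Lemma indist_Omega_common x y : rk x = Omega -> rk y = Omega -> indist x y ->
  x = y \/ exists p r, [/\ rk p = Fin r.+1, embraces x p & embraces y p].
Proof.
move=> rx ry /indist_common[->|[a [t [ra xa ya]]]]; first by left.
have [->|nxy] := pselect (x = y); first by left.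
right; have [xa'|[e ex ea]|[]] := embraces_inv xa; [|clear xa|by rewrite rx].
  by rewrite -xa' rx in ra.
have rlt_ex := wg_exc_rank hG ex; rewrite rx in rlt_ex.
case re: (rk e) rlt_ex => [r| |] // _.
  have [|ye] := embraces_up re ea ya; first by move=> /embraces_rle; rewrite re ry.
  have yne : y <> e by move=> ye'; rewrite -ye' ry in re.
  have := embraces_parent ex ye yne => /embraces_eq; rewrite rx ry => /(_ isT) yx.
  by case: nxy.
have [n ena] : exists n, embraces (elems e n) a.
  have [ea'|[z ex' _]|[_ //]] := embraces_inv ea; first by rewrite -ea' re in ra.
  by case: (exc_notV re ex').
have [r hr nr] := elems_rank n.+1 re.
have eSa : embraces (elems e n.+1) a.
  by apply: embraces_trans ena; apply: elems_embraces re (leqnSn n).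
case: r hr nr => // r hr _.
exists (elems e n.+1), r; split=> //.
  by apply: EmbExc ex _; apply: EmbElem re (EmbRefl _).
have [/embraces_rle|//] := embraces_up hr eSa ya.
by rewrite hr ry.
Qed.
End Embracing.

(** * Sequences, reversal and wtips *)

Section WalkInduction.
Variables (node : Type) (P : walk node -> Prop).
Hypothesis HP : forall a lo hi x h,
  (forall m v, h m = Wk v -> P v) -> P (Walk a lo hi x h).

(** Structural induction through the hops, which the type of walks nests under
a function. *)
Fixpoint walk_ind_hop (w : walk node) : P w :=
  let: Walk a lo hi x h := w in
  @HP a lo hi x h (fun m v (e : h m = Wk v) =>
    match h m as e0 return e0 = Wk v -> P v with
    | Br b => fun e' => False_ind _ (eq_ind (Br b)
        (fun u => if u is Br _ then True else False) I _ e')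
    | Wk v' => fun e' => eq_ind v' P (walk_ind_hop v') v
        (f_equal (fun u => if u is Wk v'' then v'' else v') e')
    end e).
End WalkInduction.

Section Sequence.
Variable node : Type.
Implicit Types (w v : walk node) (m : int).

Lemma rev_hopK_of (h : hop node) :
  (forall v, h = Wk v -> rev_walk (rev_walk v) = v) -> rev_hop (rev_hop h) = h.
Proof. by case: h => //= v /(_ v erefl) ->. Qed.

Lemma rev_walkK w : rev_walk (rev_walk w) = w.
Proof.
elim/walk_ind_hop: w => a lo hi x h IH /=; congr Walk.
- by case: lo => //= i; rewrite opprK.
- by case: hi => //= i; rewrite opprK.
- by apply/funext => m; rewrite opprK.
- apply/funext => m; have -> : - (- m - 1) - 1 = m by lia.
  by apply: rev_hopK_of => v; apply: IH.
Qed.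

Lemma rev_hopK (h : hop node) : rev_hop (rev_hop h) = h.
Proof. by apply: rev_hopK_of => v _; apply: rev_walkK. Qed.

Lemma rev_hop_Wk (h : hop node) v : rev_hop h = Wk v ->
  exists2 u, h = Wk u & v = rev_walk u.
Proof.
move=> e; exists (rev_walk v); last by rewrite rev_walkK.
by rewrite -[h]rev_hopK e.
Qed.

Lemma rev_hop_Br (h : hop node) b : rev_hop h = Br b -> h = Br b.
Proof. by move=> e; rewrite -[h]rev_hopK e. Qed.

Lemma wrank_rev w : wrank (rev_walk w) = wrank w. Proof. by case: w. Qed.
Lemma wlo_rev w : wlo (rev_walk w) = omap -%R (whi w). Proof. by case: w. Qed.
Lemma whi_rev w : whi (rev_walk w) = omap -%R (wlo w). Proof. by case: w. Qed.
Lemma wnode_rev w m : wnode (rev_walk w) m = wnode w (- m).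
Proof. by case: w. Qed.
Lemma whop_rev w m : whop (rev_walk w) m = rev_hop (whop w (- m - 1)).
Proof. by case: w. Qed.

Lemma node_idx_rev w m : node_idx (rev_walk w) m = node_idx w (- m).
Proof.
rewrite /node_idx wlo_rev whi_rev andbC.
by case: (wlo w) => [i|]; case: (whi w) => [j|] //=; lia.
Qed.

Lemma hop_idx_rev w m : hop_idx (rev_walk w) m = hop_idx w (- m - 1).
Proof.
rewrite /hop_idx !node_idx_rev andbC.
have -> : - (m + 1) = - m - 1 by lia.
by have -> : - m - 1 + 1 = - m by lia.
Qed.

Lemma interior_idx_rev w m : interior_idx (rev_walk w) m = interior_idx w (- m).
Proof.
rewrite /interior_idx !node_idx_rev andbC.
have -> : - (m + 1) = - m - 1 by lia.
by have -> : - (m - 1) = - m + 1 by lia.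
Qed.

Lemma node_idx_le w i m j : node_idx w i -> node_idx w j -> i <= m -> m <= j ->
  node_idx w m.
Proof.
rewrite /node_idx => /andP[hi _] /andP[_ hj] im mj.
case: (wlo w) hi => [a|]; case: (whi w) hj => [b|] //=; lia.
Qed.

Lemma node_hop_idx w m n : node_idx w m -> node_idx w n -> m < n -> hop_idx w m.
Proof. by move=> hm hn mn; rewrite /hop_idx hm (node_idx_le hm hn); lia. Qed.

Lemma interiorP w m : interior_idx w m -> hop_idx w (m - 1) && hop_idx w m.
Proof.
rewrite /interior_idx /hop_idx => /andP[h1 h2]; rewrite h1 h2.
by rewrite subrK !andbT /= andbb; apply: node_idx_le h1 h2 _ _; lia.
Qed.

Lemma same_walk_refl w : same_walk w w.
Proof.
elim/walk_ind_hop: w => a lo hi x h IH.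
apply: (SameWalk (k := 0)) => // m; rewrite ?addr0 //= => _.
by case E: (h m) => [b|v]; constructor; apply: IH E.
Qed.

Lemma same_hop_refl (h : hop node) : same_hop h h.
Proof. by case: h => [b|v]; constructor; apply: same_walk_refl. Qed.

Lemma walk_within_inv X B w : walk_within X B w ->
  [/\ forall m, node_idx w m -> X (wnode w m),
      forall m b, hop_idx w m -> whop w m = Br b -> B b &
      forall m v, hop_idx w m -> whop w m = Wk v -> walk_within X B v].
Proof. by case. Qed.

Lemma two_ended_length w i j : wlo w = Some i -> whi w = Some j ->
  walk_length w = \sum_(0 <= n < `|j - i|%N) hop_length (whop w (i + n%:Z)).
Proof. by case: w => a lo hi x h /= -> ->. Qed.

End Sequence.

Section WalksOf.
Variables (nu : rank) (G : wdata).
Hypothesis hG : wgraph nu G.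
Implicit Types (x y z p q : node G) (w v : walk (node G)) (m : int).

Lemma reaches_left_rev w x : reaches_left (rev_walk w) x = reaches_right w x.
Proof. by rewrite /reaches_left rev_walkK. Qed.

Lemma reaches_right_Some w b x : whi w = Some b ->
  reaches_right w x = embraces x (wnode w b).
Proof. by rewrite /reaches_right => ->. Qed.

Lemma reaches_left_Some w a x : wlo w = Some a ->
  reaches_left w x = embraces x (wnode w a).
Proof.
move=> e; rewrite /reaches_left (@reaches_right_Some _ (- a)) ?wnode_rev ?opprK //.
by rewrite whi_rev e.
Qed.

Lemma reaches_left_tip_rev a w x :
  reaches_left_tip a (rev_walk w) x <-> reaches_right_tip a w x.
Proof.
rewrite /reaches_left_tip /reaches_right_tip wrank_rev wlo_rev reaches_left_rev.
by case: (whi w) => [j|]; split=> -[].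
Qed.

Lemma reaches_right_tip_rev a w x :
  reaches_right_tip a (rev_walk w) x <-> reaches_left_tip a w x.
Proof. by rewrite -reaches_left_tip_rev rev_walkK. Qed.

Lemma walk_spec_rev w : walk_spec w -> walk_spec (rev_walk w).
Proof.
rewrite /walk_spec wrank_rev.
have specS a mu : walkS_spec a mu w -> walkS_spec a mu (rev_walk w).
  move=> [h1 h2 h3 h4]; split=> m.
  - by rewrite node_idx_rev wnode_rev; apply: h1.
  - by rewrite interior_idx_rev wnode_rev; apply: h2.
  - rewrite hop_idx_rev whop_rev !wnode_rev => /h3[v [-> hv vl vr]].
    exists (rev_walk v); split; rewrite ?wrank_rev ?reaches_left_rev //.
      by move: vr; have -> : - m - 1 + 1 = - m by lia.
    by rewrite -/(reaches_left _ _); have -> : - (m + 1) = - m - 1 by lia.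
  - rewrite interior_idx_rev !whop_rev wnode_rev => /h4.
    have -> : - (m - 1) - 1 = - m by lia.
    case=> [[v -> hv]|[v -> hv]]; [right|left]; exists (rev_walk v) => //.
      by apply/reaches_left_tip_rev.
    by apply/reaches_right_tip_rev.
case: (wrank w) => [[|k]| |]; try exact: specS.
- move=> [h1 h2]; split=> m; first by rewrite node_idx_rev wnode_rev; apply: h1.
  rewrite hop_idx_rev whop_rev !wnode_rev => /h2[b bb [-> eb]].
  exists b => //=; split=> //; rewrite eb setUC.
  have -> : - m - 1 + 1 = - m by lia.
  by have -> : - (m + 1) = - m - 1 by lia.
- move=> [c [hc hlh [hlo hhi] hr hl]]; exists (- c); split.
  + by rewrite node_idx_rev opprK.
  + by move: hlh; rewrite wlo_rev whi_rev; case: (wlo w); case: (whi w).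
  + by rewrite wlo_rev whi_rev; move: hlo hhi; case: (wlo w) => [i|]; case: (whi w) => [j|] /= *; split=> //; subst.
  + move=> m; rewrite hop_idx_rev whop_rev !wnode_rev => hm cm.
    have [|v [r [s [-> rv [h1 h2] rs [h3 h4]]]]] := hl _ hm; first by lia.
    move: h1 h3; have -> : - m - 1 + 1 = - m by lia.
    move=> h1 h3; have -> : - (m + 1) = - m - 1 by lia.
    exists (rev_walk v), r, s; split; rewrite ?wrank_rev ?reaches_left_rev //.
    by split=> //; apply/reaches_right_tip_rev.
  + move=> m; rewrite hop_idx_rev whop_rev !wnode_rev => hm cm.
    have [|v [r [s [-> rv [h1 h2] rs [h3 h4]]]]] := hr _ hm; first by lia.
    move: h2 h4; have -> : - m - 1 + 1 = - m by lia.
    move=> h2 h4; have -> : - (m + 1) = - m - 1 by lia.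
    exists (rev_walk v), r, s; split; rewrite ?wrank_rev //.
    by split=> //; apply/reaches_left_tip_rev.
Qed.

Lemma is_walk_rev w : is_walk w -> is_walk (rev_walk w).
Proof.
elim=> {}w [m0 hm0] hw _ IH; constructor.
- exists (- m0 - 1); rewrite hop_idx_rev.
  by have -> : - (- m0 - 1) - 1 = m0 by lia.
- exact: walk_spec_rev.
- move=> m v; rewrite hop_idx_rev whop_rev => hm /rev_hop_Wk[u E ->]; exact: IH hm E.
Qed.

Lemma is_walk_inv w : is_walk w ->
  [/\ exists m, hop_idx w m, walk_spec w &
      forall m v, hop_idx w m -> whop w m = Wk v -> is_walk v].
Proof. by case. Qed.

Lemma walk_within_rev X B w : walk_within X B w -> walk_within X B (rev_walk w).
Proof.
elim=> {}w hn hb _ IH; constructor.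
- by move=> m; rewrite node_idx_rev wnode_rev; apply: hn.
- move=> m b; rewrite hop_idx_rev whop_rev => hm /rev_hop_Br; exact: hb hm.
- move=> m v; rewrite hop_idx_rev whop_rev => hm /rev_hop_Wk[u E ->]; exact: IH hm E.
Qed.

Section Shift.
Variables (w w' : walk (node G)) (s : int).
Hypotheses (hr : wrank w' = wrank w)
  (hlo : wlo w' = omap (+%R s) (wlo w)) (hhi : whi w' = omap (+%R s) (whi w))
  (hn : forall m, node_idx w m -> wnode w' (m + s) = wnode w m)
  (hh : forall m, hop_idx w m -> whop w' (m + s) = whop w m).

Lemma node_idx_shift m : node_idx w' (m + s) = node_idx w m.
Proof.
rewrite /node_idx hlo hhi.
by case: (wlo w) => [i|]; case: (whi w) => [j|] //=; lia.
Qed.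

Lemma hop_idx_shift m : hop_idx w' (m + s) = hop_idx w m.
Proof. by rewrite /hop_idx addrAC !node_idx_shift. Qed.

Lemma interior_idx_shift m : interior_idx w' (m + s) = interior_idx w m.
Proof. by rewrite /interior_idx addrAC [_ + 1]addrAC !node_idx_shift. Qed.

Let unshift m : exists m0, m = m0 + s.
Proof. by exists (m - s); rewrite subrK. Qed.

(** Being a walk does not depend on the numbering, nor on the values outside
the index range. *)
Lemma is_walk_shift : is_walk w -> is_walk w'.
Proof.
have hnS m : hop_idx w m -> wnode w' (m + s + 1) = wnode w (m + 1).
  by rewrite addrAC => /andP[_ /hn].
have hn' m : hop_idx w m -> wnode w' (m + s) = wnode w m.
  by move=> /andP[/hn].
have specS a mu : walkS_spec a mu w -> walkS_spec a mu w'.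
  move=> [h1 h2 h3 h4]; split=> m; have [m0 -> {m}] := unshift m.
  - by rewrite node_idx_shift => hm; rewrite hn //; apply: h1.
  - rewrite interior_idx_shift => hm; rewrite hn' ?h2 //.
    by case/andP: (interiorP hm).
  - rewrite hop_idx_shift => hm; rewrite hh // hn' // hnS //; exact: h3.
  - rewrite interior_idx_shift => hm; have /andP[hm1 hm2] := interiorP hm.
    by rewrite hn' // hh // addrAC hh //; apply: h4.
move=> /is_walk_inv[[m1 hm1] hw hv]; constructor.
- by exists (m1 + s); rewrite hop_idx_shift.
- move: hw; rewrite /walk_spec hr; case: (wrank w) => [[|k]| |]; try exact: specS.
  + move=> [h1 h2]; split=> m; have [m0 -> {m}] := unshift m.
      by rewrite node_idx_shift => hm; rewrite hn //; apply: h1.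
    by rewrite hop_idx_shift => hm; rewrite hh // hn' // hnS //; exact: h2.
  + move=> [c [hc hlh [hl1 hl2] h3 h4]]; exists (c + s); split.
    * by rewrite node_idx_shift.
    * by move: hlh; rewrite hlo hhi; case: (wlo w); case: (whi w).
    * by rewrite hlo hhi; case: (wlo w) hl1 => [i|]; case: (whi w) hl2 => [j|] /= *; split=> //; subst;
        rewrite addrC.
    * move=> m; have [m0 -> {m}] := unshift m.
      rewrite hop_idx_shift lerD2r => hm cm; rewrite hh // hn' // hnS //; exact: h3.
    * move=> m; have [m0 -> {m}] := unshift m.
      rewrite hop_idx_shift ltrD2r => hm cm; rewrite hh // hn' // hnS //; exact: h4.
- move=> m v; have [m0 -> {m}] := unshift m.
  by rewrite hop_idx_shift => hm; rewrite (hh hm); exact: hv.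
Qed.
End Shift.

Lemma node_idx_tail w m n :
  node_idx (tail w m) n = (m <= n) && (if whi w is Some j then n <= j else true).
Proof. by []. Qed.

(** One-ended walks have tails of the same rank; the first wnode of the tail of
an arrow-omega-walk is its new start. *)
Lemma is_walk_tail w i m : is_walk w -> wlo w = Some i -> whi w = None ->
  i <= m -> is_walk (tail w m).
Proof.
move=> /is_walk_inv[_ hw hv] hlo hhi im.
have hn n : node_idx (tail w m) n = (m <= n) by rewrite node_idx_tail hhi andbT.
have hnw n : node_idx w n = (i <= n) by rewrite /node_idx hlo hhi andbT.
have hp n : hop_idx (tail w m) n = (m <= n) by rewrite /hop_idx !hn; lia.
have hpw n : hop_idx w n = (i <= n) by rewrite /hop_idx !hnw; lia.
have hi n : interior_idx (tail w m) n = (m <= n - 1) by rewrite /interior_idx !hn; lia.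
have hiw n : interior_idx w n = (i <= n - 1) by rewrite /interior_idx !hnw; lia.
constructor.
- by exists m; rewrite hp.
- have specS a mu : walkS_spec a mu w -> walkS_spec a mu (tail w m).
    move=> [h1 h2 h3 h4]; split=> n; rewrite ?hn ?hi ?hp => mn.
    + by apply: h1; rewrite hnw; lia.
    + by apply: h2; rewrite hiw; lia.
    + by apply: h3; rewrite hpw; lia.
    + by apply: h4; rewrite hiw; lia.
  move: hw; rewrite /walk_spec [wrank (tail w m)]/=.
  case: (wrank w) => [[|k]| |]; try exact: specS.
  + move=> [h1 h2]; split=> n; rewrite ?hn ?hp => mn.
      by apply: h1; rewrite hnw; lia.
    by apply: h2; rewrite hpw; lia.
  + move=> [c [_ _ + h3 h4]]; rewrite hlo => -[ic _].
    exists m; split; rewrite ?hn //=; rewrite ?hhi //.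
      by move=> n; rewrite hp => mn _; apply: h3; rewrite ?hpw; lia.
    by move=> n; rewrite hp => mn; lia.
- move=> n v; rewrite hp => mn; apply: hv; rewrite hpw; lia.
Qed.

Lemma tips_wtip y t : tips y t -> exists2 a, rsucc a = Some (rk y) & wtip a t.
Proof.
move=> yt.
have nr0 : ~ (rk y = Fin 0 \/ rk y = ArrowOmega).
  by move=> /(wg_tips_none hG) [h _]; rewrite h in yt.
have [a ea] : exists a, rsucc a = Some (rk y).
  case: (rk y) nr0 => [[|k]| |] nr0.
  - by case: nr0; left.
  - by exists (Fin k).
  - by case: nr0; right.
  - by exists ArrowOmega.
by exists a => //; have [_] := wg_tips_nonempty hG ea erefl; apply.
Qed.

Lemma tips_tail y t w m : tips y t -> t (tail w m) ->
  rsucc (wrank w) = Some (rk y).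
Proof. by move=> /tips_wtip[a ea [w0 h0 ->]] [[_ /= -> _] _]. Qed.

(** A wtip is a class for eventual identity, so it is determined by the far
part of a walk. *)
Lemma reaches_right_agree w w' (s N : int) x :
  wrank w' = wrank w -> whi w = None -> whi w' = None ->
  (forall m, N <= m -> wnode w' (m + s) = wnode w m /\
                       whop w' (m + s) = whop w m) ->
  reaches_right w x -> reaches_right w' x.
Proof.
move=> hr hhi hhi' agr; rewrite /reaches_right hhi hhi'.
move=> [t [m [[y xy yt] hm tm]]].
have /tips_wtip[a ea [w0 h0 et]] := yt.
move: (tm); rewrite et => -[[wt rt _ _] [k [N0 ev]]].
pose lb := if wlo w' is Some i then i - s else 0.
pose M := Num.max (Num.max m N) (Num.max lb N0).
have mM : m <= M by rewrite /M !le_max lexx.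
have NM : N <= M by rewrite /M !le_max lexx orbT.
have lM : lb <= M by rewrite /M !le_max lexx !orbT.
have N0M : N0 <= M by rewrite /M !le_max lexx !orbT.
exists t, (M + s); split; first by exists y.
  rewrite /node_idx hhi' andbT; move: lM; rewrite /lb; case: (wlo w') => [i|] //; lia.
rewrite et; split.
  split; [|by rewrite /= hr|by []|exact: hhi'].
  have wM : is_walk (tail w M) by exact: (is_walk_tail (w := tail w m) wt erefl hhi mM).
  apply: (is_walk_shift (w := tail w M) (s := s) _ _ _ _ _ wM).
  - exact: hr.
  - by rewrite /= addrC.
  - by rewrite /= hhi hhi'.
  - by move=> n; rewrite node_idx_tail => /andP[Mn _]; case: (agr n (le_trans NM Mn)).
  - by move=> n /andP[+ _]; rewrite node_idx_tail => /andP[Mn _]; case: (agr n (le_trans NM Mn)).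
exists (k - s), (M + s) => n Mn.
have [|_ h2 h3 h4] := ev (n - s); first by lia.
have [|a1 a2] := agr (n - s); first by lia.
rewrite subrK in a1 a2; have ek : n - s + k = n + (k - s) by lia.
split.
- by rewrite node_idx_tail hhi' andbT.
- by rewrite -ek.
- by rewrite /= a1 -ek -h3.
- by rewrite /= a2 -ek.
Qed.
End WalksOf.

(** * Ends of walks *)

(** At a wnode of such a rank no walk can arrive through an [a]-wtip, which only
wnodes of rank at least [a + 1] embrace. *)
Definition joint_rank (a r : rank) : bool :=
  if a is Fin _ then rle r a else rlt r ArrowOmega.

Definition walk_in (G : wdata) (S : wsubgraph G) (w : walk (node G)) :=
  is_walk w /\ walk_within (snode S) (sbranch S) w.

Section Reach.
Variables (nu : rank) (G : wdata).
Hypothesis hG : wgraph nu G.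
Implicit Types (x y z p q : node G) (w v : walk (node G)) (m : int).

Lemma embraces_tip_trans x y t : embraces x y -> embraces_tip y t -> embraces_tip x t.
Proof. by move=> xy [z yz zt]; exists z => //; apply: embraces_trans yz. Qed.

Lemma reaches_right_trans x y w : embraces x y -> reaches_right w y ->
  reaches_right w x.
Proof.
move=> xy; rewrite /reaches_right; case: (whi w) => [b|].
  exact: embraces_trans.
by move=> [t [m [h1 h2 h3]]]; exists t, m; split=> //; apply: embraces_tip_trans h1.
Qed.

Lemma reaches_left_trans x y w : embraces x y -> reaches_left w y ->
  reaches_left w x.
Proof. exact: reaches_right_trans. Qed.

Lemma node_idx_hop w m : is_walk w -> node_idx w m ->
  hop_idx w m \/ hop_idx w (m - 1).
Proof.
move=> /is_walk_inv[[m0 /andP[h0 h1]] _ _] hm.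
have [mm0|m0m] := leP m m0; [left|right].
  by apply: node_hop_idx hm h1 _; lia.
apply: (@node_hop_idx _ _ _ m) => //; last lia.
by apply: node_idx_le h0 hm _ _; lia.
Qed.

Lemma walkV_node w m : is_walk w -> wrank w = ArrowOmega -> node_idx w m ->
  exists r, rk (wnode w m) = Fin r.
Proof.
move=> hw rw hm; have [_ + _] := is_walk_inv hw; rewrite /walk_spec rw.
move=> [c [_ _ _ hr hl]].
have hn n : hop_idx w n -> (exists r, rk (wnode w n) = Fin r) /\
    (exists r, rk (wnode w (n + 1)) = Fin r).
  move=> hn; have [cn|nc] := leP c n.
    by have [v [r [s [_ _ [h1 h2] _ _]]]] := hr n hn cn; split; eexists; eassumption.
  by have [v [r [s [_ _ [h1 h2] _ _]]]] := hl n hn nc; split; eexists; eassumption.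
have [/hn[]//|/hn[_]] := node_idx_hop hw hm; by rewrite subrK.
Qed.

Lemma walk_node_rank w m : is_walk w -> node_idx w m ->
  rle (rk (wnode w m)) (wrank w).
Proof.
move=> hw hm; have [_ hs _] := is_walk_inv hw; move: hs; rewrite /walk_spec.
case rw: (wrank w) => [[|k]| |].
- by move=> [-> //].
- by move=> [h _ _ _]; apply: h.
- by move=> _; have [r ->] := walkV_node hw rw hm.
- by move=> [h _ _ _]; apply: h.
Qed.

Lemma two_ended_lt w i j : is_walk w -> wlo w = Some i -> whi w = Some j -> i < j.
Proof.
move=> /is_walk_inv[[m0 /andP[h0 h1]] _ _] hi hj; move: h0 h1.
by rewrite /node_idx hi hj; lia.
Qed.

Lemma walk_length_rev w : is_walk w -> walk_length (rev_walk w) = walk_length w.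
Proof.
elim=> {}w hex hs hw IH; have ww : is_walk w by exact: IsWalk hex hs hw.
case hi: (wlo w) => [i|]; case hj : (whi w) => [j|]; try by
  move: hi hj; case: {hex hs hw IH ww} w => a lo hi x h /= -> ->.
have ltij := two_ended_lt ww hi hj.
rewrite (two_ended_length (i := - j) (j := - i)); last 2 first.
- by rewrite wlo_rev hj.
- by rewrite whi_rev hi.
rewrite (two_ended_length hi hj).
have -> : `|- i - - j|%N = `|j - i|%N by lia.
rewrite big_nat_rev /=; apply: eq_big_nat => n /andP[_ nlt].
rewrite whop_rev; set m := (X in whop w X); have -> : m = i + n%:Z by rewrite /m; lia.
have hm : hop_idx w (i + n%:Z) by rewrite /hop_idx /node_idx hi hj; lia.
case E: (whop w _) => [b|u] /=; [reflexivity|exact: IH hm E].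
Qed.

Lemma whi_node_idx w b : is_walk w -> whi w = Some b -> node_idx w b.
Proof.
move=> /is_walk_inv[[m0 /andP[h0 h1]] _ _] hb; rewrite /node_idx hb lexx andbT.
move: h1; rewrite /node_idx hb; case: (wlo w) => [i|] //=; lia.
Qed.

Lemma whi_hop_idx w b : is_walk w -> whi w = Some b -> hop_idx w (b - 1).
Proof.
move=> hw hb; have hn := whi_node_idx hw hb.
have [|//] := node_idx_hop hw hn.
by move=> /andP[_]; rewrite /node_idx hb; case: (wlo w) => [i|] /=; lia.
Qed.

Lemma whi_revS w a : wlo w = Some a -> whi (rev_walk w) = Some (- a).
Proof. by rewrite whi_rev => ->. Qed.

Lemma wlo_node_idx w a : is_walk w -> wlo w = Some a -> node_idx w a.
Proof.
move=> /is_walk_rev hw /whi_revS ha; have := whi_node_idx hw ha.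
by rewrite node_idx_rev opprK.
Qed.

Lemma wlo_hop_idx w a : is_walk w -> wlo w = Some a -> hop_idx w a.
Proof.
move=> /is_walk_rev hw /whi_revS ha; have := whi_hop_idx hw ha.
by rewrite hop_idx_rev; have -> : - (- a - 1) - 1 = a by lia.
Qed.

Lemma walk_spec_S w a mu : is_walk w -> rsucc a = Some mu -> wrank w = mu ->
  walkS_spec a mu w.
Proof.
move=> /is_walk_inv[_ + _] ea rw; rewrite /walk_spec rw.
by case: a ea => [k| |] //= [<-].
Qed.

Lemma spec_walk_S w a mu : rsucc a = Some mu -> wrank w = mu ->
  walkS_spec a mu w -> walk_spec w.
Proof. by move=> ea rw; rewrite /walk_spec rw; case: a ea => [k| |] //= [<-]. Qed.

Lemma two_ended_rank w i j : is_walk w -> wlo w = Some i -> whi w = Some j ->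
  wrank w <> ArrowOmega.
Proof.
move=> /is_walk_inv[_ + _] hi hj rw; rewrite /walk_spec rw => -[c [_ + _ _ _]].
by rewrite hi hj.
Qed.

Section Sub.
Variables (rho : rank) (S : wsubgraph G).
Hypothesis S_tips : forall t w p, rle (rk p) rho -> tips p t -> t w ->
  walk_within (snode S) (sbranch S) w -> snode S p.

Lemma walk_in_rev w : walk_in S w -> walk_in S (rev_walk w).
Proof. by move=> [h1 h2]; exact: (conj (is_walk_rev h1) (walk_within_rev h2)). Qed.

Lemma walk_in_hop w m v : walk_in S w -> hop_idx w m -> whop w m = Wk v -> walk_in S v.
Proof.
move=> [/is_walk_inv[_ _ h1] /walk_within_inv[_ _ h2]] hm e.
exact: (conj (h1 _ _ hm e) (h2 _ _ hm e)).
Qed.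

Lemma walk_in_node w m : walk_in S w -> node_idx w m -> snode S (wnode w m).
Proof. by move=> [_ /walk_within_inv[h _ _]]; apply: h. Qed.

(** An infinite end is treated like a finite one: the wnode that contains the
wtip plays the role of a terminal wnode, with a rank one above that of the
walk. *)
Lemma end_right w x : walk_in S w -> reaches_right w x ->
  exists p, [/\ embraces x p, reaches_right w p, (rle (rk p) rho -> snode S p) &
    (exists2 b, whi w = Some b & p = wnode w b) \/
    (whi w = None /\ rsucc (wrank w) = Some (rk p))].
Proof.
move=> [hw hin]; rewrite {1}/reaches_right; case hb: (whi w) => [b|].
  move=> xb; exists (wnode w b); split=> //.
  - by rewrite /reaches_right hb; constructor.
  - move=> _; apply: walk_in_node (conj hw hin) _; exact: whi_node_idx.
  - by left; exists b.
move=> [t [m [[p xp pt] hm tm]]]; exists p; split=> //.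
- by rewrite /reaches_right hb; exists t, m; split=> //; exists p => //; constructor.
- move=> hp; apply: S_tips hp pt tm _.
  have [h1 h2 h3] := walk_within_inv hin.
  have hidx n : node_idx (tail w m) n -> node_idx w n.
    rewrite node_idx_tail hb andbT => mn; move: hm; rewrite /node_idx hb !andbT.
    by case: (wlo w) => [i|] //; lia.
  have hhop n : hop_idx (tail w m) n -> hop_idx w n.
    by rewrite /hop_idx => /andP[/hidx -> /hidx ->].
  constructor.
  + by move=> n /hidx; apply: h1.
  + by move=> n b /hhop; apply: h2.
  + by move=> n v /hhop; apply: h3.
- by right; split=> //; apply: (tips_tail hG pt tm).
Qed.

Lemma end_left w x : walk_in S w -> reaches_left w x ->
  exists p, [/\ embraces x p, reaches_left w p, (rle (rk p) rho -> snode S p) &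
    (exists2 b, wlo w = Some b & p = wnode w b) \/
    (wlo w = None /\ rsucc (wrank w) = Some (rk p))].
Proof.
move=> /walk_in_rev hw /(end_right hw)[p [h1 h2 h3 h4]]; exists p; split=> //.
case: h4 => [[b hb ->]|[hn hs]]; [left | right].
  exists (- b); last by rewrite wnode_rev.
  by move: hb; rewrite whi_rev; case: (wlo w) => //= i [<-]; rewrite opprK.
by move: hn; rewrite whi_rev -(wrank_rev w); case: (wlo w).
Qed.

(** When no [a]-wtip is involved, the end has moved to a wnode at which walks of
rank [a] can be joined. *)
Lemma end_right_small a w x : a <> Omega -> walk_in S w -> rle (wrank w) a ->
  ~ reaches_right_tip a w x -> reaches_right w x ->
  exists p, [/\ embraces x p, reaches_right w p, (rle (rk p) rho -> snode S p) &
    joint_rank a (rk p)].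
Proof.
move=> aO hw rw ntip wx; have [p [h1 h2 h3 h4]] := end_right hw wx.
exists p; split=> //; have [hb|hb] := h4.
  have [b hb' ->] := hb; have hi := whi_node_idx hw.1 hb'.
  have hr := walk_node_rank hw.1 hi.
  case: a aO rw {ntip} => [a| |] //= _ rw; first exact: rle_trans hr rw.
  case ew : (wrank w) rw hr => [c| |] // _.
    by case: (rk _).
  by have [r ->] := walkV_node hw.1 ew hi.
have [hn hs] := hb.
have ltw : rlt (wrank w) a.
  by have [ea|//] := rle_eqVlt rw; case: ntip; split.
case: a aO ltw {rw ntip} hs => [a| |] // _; case: (wrank w) => [c| |] //=.
  by rewrite /rlt /= -ltnNge => ca [<-].
by move=> _ [<-].
Qed.

Lemma end_left_small a w x : a <> Omega -> walk_in S w -> rle (wrank w) a ->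
  ~ reaches_left_tip a w x -> reaches_left w x ->
  exists p, [/\ embraces x p, reaches_left w p, (rle (rk p) rho -> snode S p) &
    joint_rank a (rk p)].
Proof.
move=> aO /walk_in_rev hw; rewrite -wrank_rev => rw ntip.
by apply: end_right_small => // /reaches_right_tip_rev.
Qed.
End Sub.
End Reach.

(** * Splicing two walks *)

(** All the concatenations below have this form.  The hop [H] is the last hop of
[v1] or the first one of [v2] when the walks are juxtaposed, and a walk made
for the purpose otherwise. *)
Definition splice (node : Type) (v1 : walk node) (k : int) (H : hop node)
    (v2 : walk node) (l : int) : walk node :=
  Walk (wrank v1) (wlo v1) (omap (+%R (k + 1 - l)) (whi v2))
    (fun m => if m <= k then wnode v1 m else wnode v2 (m - k - 1 + l))
    (fun m => if m < k then whop v1 m else if m == k then H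
              else whop v2 (m - k - 1 + l)).

Lemma sum_nat_cat (V : nmodType) (F : nat -> V) a b :
  \sum_(0 <= n < a + b) F n =
  \sum_(0 <= n < a) F n + \sum_(0 <= n < b) F (a + n)%N.
Proof.
rewrite (big_cat_nat (n := a)) ?leq_addr //=; congr (_ + _).
rewrite -{1}[a]add0n big_addn addKn; apply: eq_big_nat => n _.
by rewrite addnC.
Qed.

Section Splice.
Variables (node : Type) (v1 v2 : walk node) (k l : int) (H : hop node).
Local Notation sp := (splice v1 k H v2 l).

Lemma splice_node m : m <= k -> wnode sp m = wnode v1 m.
Proof. by move=> /= ->. Qed.

Lemma splice_node_right m : l <= m -> wnode sp (m + (k + 1 - l)) = wnode v2 m.
Proof.
move=> lm /=; case: ifP => [|_]; first by lia.
congr (wnode v2 _); lia.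
Qed.

Lemma splice_hop m : m < k -> whop sp m = whop v1 m.
Proof. by move=> /= ->. Qed.

Lemma splice_hop_mid : whop sp k = H.
Proof. by rewrite /= ltxx eqxx. Qed.

Lemma splice_hop_right m : l <= m -> whop sp (m + (k + 1 - l)) = whop v2 m.
Proof.
move=> lm /=; case: ifP => [|_]; first by lia.
case: ifP => [|_]; first by lia.
congr (whop v2 _); lia.
Qed.

Lemma splice_idx_cases (m : int) :
  [\/ m < k, m = k | exists2 n, l <= n & m = n + (k + 1 - l)].
Proof.
have [mk|km|->] := ltgtP m k; [by constructor 1| |by constructor 2].
by constructor 3; exists (m - (k + 1 - l)); lia.
Qed.

Lemma splice_idx_cases2 (m : int) :
  m <= k \/ exists2 n, l <= n & m = n + (k + 1 - l).
Proof.
have [mk|->|h] := splice_idx_cases m; [left; exact: ltW|by left|by right].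
Qed.

Hypotheses (hk : node_idx v1 k) (hl : node_idx v2 l).

Lemma splice_node_idx m : m <= k -> node_idx sp m = node_idx v1 m.
Proof.
move=> mk; move: hk hl; rewrite /node_idx /=.
by case: (wlo v1) => [i|]; case: (whi v1) => [j|]; case: (whi v2) => [j'|] //=; lia.
Qed.

Lemma splice_node_idx_right m : l <= m ->
  node_idx sp (m + (k + 1 - l)) = node_idx v2 m.
Proof.
move=> mk; move: hk hl; rewrite /node_idx /=.
by case: (wlo v1) => [i|]; case: (wlo v2) => [i'|]; case: (whi v2) => [j'|] //=; lia.
Qed.

Lemma splice_hop_idx m : m < k -> hop_idx sp m = hop_idx v1 m.
Proof. by move=> mk; rewrite /hop_idx !splice_node_idx //; lia. Qed.

Lemma splice_hop_idx_right m : l <= m ->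
  hop_idx sp (m + (k + 1 - l)) = hop_idx v2 m.
Proof.
move=> lm; rewrite /hop_idx (_ : m + (k + 1 - l) + 1 = m + 1 + (k + 1 - l)); last lia.
by rewrite !splice_node_idx_right //; lia.
Qed.

Lemma splice_interior_idx m : m < k -> interior_idx sp m = interior_idx v1 m.
Proof. by move=> mk; rewrite /interior_idx !splice_node_idx //; lia. Qed.

Lemma splice_interior_idx_k : interior_idx sp k -> node_idx v1 (k - 1).
Proof. by move=> /andP[+ _]; rewrite splice_node_idx //; lia. Qed.

Lemma splice_interior_idx_l : interior_idx sp (l + (k + 1 - l)) -> node_idx v2 (l + 1).
Proof.
rewrite /interior_idx (_ : l + (k + 1 - l) + 1 = l + 1 + (k + 1 - l)); last lia.
move=> /andP[_]; rewrite splice_node_idx_right //; lia.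
Qed.

Lemma splice_interior_idx_right m : l < m ->
  interior_idx sp (m + (k + 1 - l)) = interior_idx v2 m.
Proof.
move=> lm; rewrite /interior_idx (_ : m + (k + 1 - l) + 1 = m + 1 + (k + 1 - l)); last lia.
rewrite (_ : m + (k + 1 - l) - 1 = m - 1 + (k + 1 - l)); last lia.
by rewrite !splice_node_idx_right //; lia.
Qed.

Lemma splice_hop_idx_mid : hop_idx sp k.
Proof.
rewrite /hop_idx splice_node_idx // hk.
have -> : k + 1 = l + (k + 1 - l) by lia.
by rewrite splice_node_idx_right.
Qed.

Lemma splice_node_mid : wnode sp (k + 1) = wnode v2 l.
Proof.
have -> : k + 1 = l + (k + 1 - l) by lia.
by rewrite splice_node_right.
Qed.

Lemma splice_within X B :
  walk_within X B v1 -> walk_within X B v2 ->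
  (forall b, H = Br b -> B b) -> (forall v, H = Wk v -> walk_within X B v) ->
  walk_within X B sp.
Proof.
move=> /walk_within_inv[n1 b1 w1] /walk_within_inv[n2 b2 w2] hb hw.
constructor=> m.
- have [mk|[n ln ->]] := splice_idx_cases2 m.
    by rewrite splice_node_idx // splice_node //; apply: n1.
  by rewrite splice_node_idx_right // splice_node_right //; apply: n2.
- have [mk b|-> b|[n ln ->] b] := splice_idx_cases m.
  + by rewrite splice_hop_idx // splice_hop //; apply: b1.
  + by rewrite splice_hop_mid => _; apply: hb.
  + by rewrite splice_hop_idx_right // splice_hop_right //; apply: b2.
- have [mk v|-> v|[n ln ->] v] := splice_idx_cases m.
  + rewrite (@splice_hop_idx m mk) (@splice_hop m mk); exact: w1.
  + rewrite splice_hop_mid => _; exact: hw.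
  + rewrite (@splice_hop_idx_right n ln) (@splice_hop_right n ln); exact: w2.
Qed.

(** The parts of [v1] and [v2] that are cut off can only make the sum
smaller. *)
Lemma splice_length i1 j1 i2 j2 :
  wlo v1 = Some i1 -> whi v1 = Some j1 -> wlo v2 = Some i2 -> whi v2 = Some j2 ->
  ole (walk_length sp) (walk_length v1 + hop_length H + walk_length v2).
Proof.
move=> e1 e2 e3 e4.
have [b1 b2] : i1 <= k /\ k <= j1 by move: hk; rewrite /node_idx e1 e2 => /andP.
have [b3 b4] : i2 <= l /\ l <= j2 by move: hl; rewrite /node_idx e3 e4 => /andP.
rewrite (two_ended_length e1 e2) (two_ended_length e3 e4).
rewrite (two_ended_length (w := sp) (i := i1) (j := (k + 1 - l) + j2)) ?e1 //; last first.
  by rewrite /= e4.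
set F := fun n : nat => hop_length (whop sp (i1 + n%:Z)).
have [eA eB eC eD] : [/\ exists A : nat, k - i1 = A%:Z, exists B : nat, j2 - l = B%:Z,
    exists C : nat, l - i2 = C%:Z & exists D : nat, j1 - k = D%:Z].
  by split; [exists (absz (k - i1)%R)|exists (absz (j2 - l)%R)|exists (absz (l - i2)%R)|exists (absz (j1 - k)%R)]; lia.
case: eA eB eC eD => [A eA] [B eB] [C eC] [D eD].
rewrite (_ : absz ((k + 1 - l) + j2 - i1)%R = (A + (1 + B))%N); last lia.
rewrite (_ : absz (j1 - i1)%R = (A + D)%N); last lia.
rewrite (_ : absz (j2 - i2)%R = (C + B)%N); last lia.
rewrite !sum_nat_cat addrA; apply: ole_add; first apply: ole_add.
- rewrite [X in ole X _](_ : _ = \sum_(0 <= n < A) hop_length (whop v1 (i1 + n%:Z))).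
    exact: ole_addr.
  by apply: eq_big_nat => n nlt; rewrite splice_hop //; lia.
- rewrite big_nat1 addn0; have -> : i1 + A%:Z = k by lia.
  by rewrite splice_hop_mid; apply: ole_refl.
- rewrite [X in ole X _](_ : _ = \sum_(0 <= n < B)
      hop_length (whop v2 (i2 + (C + n)%N%:Z))).
    exact: ole_addl.
  apply: eq_big_nat => n nlt; congr hop_length.
  rewrite -splice_hop_right; last lia.
  congr (whop sp _); lia.
Qed.
End Splice.

Section SpliceWalk.
Variables (nu : rank) (G : wdata).
Hypothesis hG : wgraph nu G.
Variables (v1 v2 : walk (node G)) (k l : int) (H : hop (node G)).
Hypotheses (hk : node_idx v1 k) (hl : node_idx v2 l).
Local Notation sp := (splice v1 k H v2 l).

Lemma splice_reaches_left x : reaches_left v1 x -> reaches_left sp x.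
Proof.
case e: (wlo v1) => [i|]; last first.
  apply: (reaches_right_agree hG (s := 0) (N := - k + 1)).
  - by rewrite !wrank_rev.
  - by rewrite whi_rev e.
  - by rewrite whi_rev /= e.
  - move=> m km; rewrite addr0 !wnode_rev !whop_rev.
    by split; [rewrite splice_node //; lia | rewrite splice_hop //; lia].
rewrite (reaches_left_Some _ e) (reaches_left_Some (w := sp) _ e).
rewrite splice_node //.
by move: hk; rewrite /node_idx e => /andP[].
Qed.

Lemma splice_reaches_right x : wrank v2 = wrank v1 ->
  reaches_right v2 x -> reaches_right sp x.
Proof.
move=> hr; case e: (whi v2) => [j|]; last first.
  apply: (reaches_right_agree hG (s := k + 1 - l) (N := l)) => //.
  - by rewrite /= e.
  - by move=> m km; rewrite splice_node_right // splice_hop_right.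
rewrite (reaches_right_Some _ e) (reaches_right_Some (w := sp) (b := j + (k + 1 - l))).
  by rewrite splice_node_right //; move: hl; rewrite /node_idx e => /andP[].
by rewrite /= e /= addrC.

Qed.

Lemma splice_subwalks :
  (forall m v, m < k -> hop_idx v1 m -> whop v1 m = Wk v -> is_walk v) ->
  is_walk v2 -> (forall v, H = Wk v -> is_walk v) ->
  forall m v, hop_idx sp m -> whop sp m = Wk v -> is_walk v.
Proof.
move=> w1 /is_walk_inv[_ _ w2] hv m v.
have [mk|->|[n ln ->]] := splice_idx_cases k l m.
- rewrite (@splice_hop_idx _ v1 v2 k l H hk hl m mk) (@splice_hop _ v1 v2 k l H m mk).
  exact: w1.
- rewrite splice_hop_mid => _; exact: hv.
- rewrite (@splice_hop_idx_right _ v1 v2 k l H hk hl n ln) (@splice_hop_right _ v1 v2 k l H n ln); exact: w2.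
Qed.

Lemma splice_is_walk0 : is_walk v1 -> is_walk v2 ->
  wrank v1 = Fin 0 -> wrank v2 = Fin 0 ->
  (exists2 b, branch b & H = Br b /\ b = [set wnode v1 k; wnode v2 l]) ->
  is_walk sp.
Proof.
move=> w1 w2 r1 r2 hH; constructor.
- by exists k; apply: splice_hop_idx_mid.
- have [_ + _] := is_walk_inv w1; have [_ + _] := is_walk_inv w2.
  rewrite /walk_spec /= r1 r2 => -[n2 h2] [n1 h1]; split=> m.
    have [mk|[n ln ->]] := splice_idx_cases2 k l m.
      by rewrite splice_node_idx // splice_node //; apply: n1.
    by rewrite splice_node_idx_right // splice_node_right //; apply: n2.
  have [mk|->|[n ln ->]] := splice_idx_cases k l m.
  + rewrite splice_hop_idx // splice_hop // !splice_node //; [exact: h1|lia|lia].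
  + by rewrite splice_hop_mid splice_node // splice_node_mid.
  + rewrite splice_hop_idx_right // splice_hop_right // splice_node_right //.
    rewrite (_ : n + (k + 1 - l) + 1 = n + 1 + (k + 1 - l)); last lia.
    by rewrite splice_node_right //; [exact: h2|lia].
- apply: splice_subwalks; [|exact: w2|by case: hH => b _ [-> _]].
  by move=> m v _; have [_ _ h1] := is_walk_inv w1; exact: h1.
Qed.

(** Only the wnodes at the two ends of [h] have new neighbours, so the wtip
condition has to be checked only there, and only where they are interior. *)
Lemma splice_is_walkS a mu h : rsucc a = Some mu -> H = Wk h ->
  is_walk v1 -> is_walk v2 -> wrank v1 = mu -> wrank v2 = mu ->
  is_walk h -> rlt (wrank h) mu ->
  reaches_left h (wnode v1 k) -> reaches_right h (wnode v2 l) ->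
  (node_idx v1 (k - 1) -> rk (wnode v1 k) = mu /\
     ((exists2 v, whop v1 (k - 1) = Wk v & reaches_right_tip a v (wnode v1 k)) \/
      reaches_left_tip a h (wnode v1 k))) ->
  (node_idx v2 (l + 1) -> rk (wnode v2 l) = mu /\
     (reaches_right_tip a h (wnode v2 l) \/
      exists2 v, whop v2 l = Wk v & reaches_left_tip a v (wnode v2 l))) ->
  is_walk sp.
Proof.
move=> ea eH w1 w2 r1 r2 wh rh hL hR cL cR; constructor.
- by exists k; apply: splice_hop_idx_mid.
- have [p1 p2 p3 p4] := walk_spec_S w1 ea r1.
  have [q1 q2 q3 q4] := walk_spec_S w2 ea r2.
  apply: (spec_walk_S (w := sp) ea r1); split=> m.
  + have [mk|[n ln ->]] := splice_idx_cases2 k l m.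
      by rewrite splice_node_idx // splice_node //; apply: p1.
    by rewrite splice_node_idx_right // splice_node_right //; apply: q1.
  + have [mk|->|[n ln ->]] := splice_idx_cases k l m.
    * by rewrite splice_interior_idx // splice_node ?ltW //; apply: p2.
    * by move=> /(splice_interior_idx_k hk hl)/cL[]; rewrite splice_node.
    * rewrite splice_node_right //; move: ln; rewrite le_eqVlt => /orP[/eqP <-|ln].
        by move=> /(splice_interior_idx_l hk hl)/cR[].
      by rewrite splice_interior_idx_right //; apply: q2.
  + have [mk|->|[n ln ->]] := splice_idx_cases k l m.
    * rewrite splice_hop_idx // splice_hop // !splice_node; [exact: p3|lia|lia].
    * by rewrite splice_hop_mid splice_node // splice_node_mid // => _; exists h.
    * rewrite splice_hop_idx_right // splice_hop_right // splice_node_right //.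
      rewrite (_ : n + (k + 1 - l) + 1 = n + 1 + (k + 1 - l)); last lia.
      by rewrite splice_node_right //; [exact: q3|lia].
  + have [mk|->|[n ln ->]] := splice_idx_cases k l m.
    * rewrite splice_interior_idx // splice_node ?ltW // !splice_hop //; last lia.
      exact: p4.
    * move=> /(splice_interior_idx_k hk hl)/cL[_]; rewrite splice_node //.
      rewrite splice_hop //; last lia.
      by rewrite splice_hop_mid => -[?|hh]; [left|right; exists h].
    * rewrite splice_node_right // splice_hop_right //.
      move: ln; rewrite le_eqVlt => /orP[/eqP <-|ln].
        rewrite (_ : l + (k + 1 - l) - 1 = k); last lia.
        move=> /(splice_interior_idx_l hk hl)/cR[_].
        by rewrite splice_hop_mid => -[hh|?]; [left; exists h|right].
      rewrite splice_interior_idx_right //.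
      rewrite (_ : n + (k + 1 - l) - 1 = n - 1 + (k + 1 - l)); last lia.
      by rewrite splice_hop_right //; [exact: q4|lia].
- apply: splice_subwalks; [|exact: w2|].
  by move=> m v _; have [_ _ h1] := is_walk_inv w1; exact: h1.
  by rewrite eH => v [<-]; exact: wh.
Qed.

Definition fwd_hop (w : walk (node G)) (m : int) := exists v r s,
  [/\ whop w m = Wk v, wrank v = Fin s,
      rk (wnode w m) = Fin r /\ rk (wnode w (m + 1)) = Fin s.+1,
      (r < s.+1)%N &
      reaches_left v (wnode w m) /\ reaches_right_tip (Fin s) v (wnode w (m + 1))].

Definition bwd_hop (w : walk (node G)) (m : int) := exists v r s,
  [/\ whop w m = Wk v, wrank v = Fin s,
      rk (wnode w (m + 1)) = Fin r /\ rk (wnode w m) = Fin s.+1,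
      (r < s.+1)%N &
      reaches_right v (wnode w (m + 1)) /\ reaches_left_tip (Fin s) v (wnode w m)].

(** The start of the spliced walk is the [k]-th wnode of [v1], from which the
ranks increase on both sides.  The second alternative for [v1] covers
one-ended results, where [v1] contributes a single wnode. *)
Lemma splice_is_walkV h r s : wrank v1 = ArrowOmega -> H = Wk h -> is_walk h ->
  (is_walk v1 /\ wlo v1 = None \/ wlo v1 = Some k) ->
  (forall m, hop_idx v1 m -> m < k -> bwd_hop v1 m) ->
  is_walk v2 -> whi v2 = None ->
  (forall m, hop_idx v2 m -> l <= m -> fwd_hop v2 m) ->
  wrank h = Fin s -> rk (wnode v1 k) = Fin r -> rk (wnode v2 l) = Fin s.+1 ->
  (r < s.+1)%N ->
  reaches_left h (wnode v1 k) -> reaches_right_tip (Fin s) h (wnode v2 l) ->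
  is_walk sp.
Proof.
move=> r1 eH wh c1 b1 w2 hhi f2 rh rk1 rk2 rs hL hR; constructor.
- by exists k; apply: splice_hop_idx_mid.
- rewrite /walk_spec /= r1; exists k; split.
  + by rewrite splice_node_idx.
  + by rewrite /= hhi andbF.
  + by rewrite /= hhi; case: c1 => [[_ ->]|->].
  + move=> m; have [mk|->|[n ln ->]] := splice_idx_cases k l m; first lia.
      move=> _ _; rewrite splice_hop_mid splice_node // splice_node_mid //.
      by exists h, r, s.
    rewrite splice_hop_idx_right // splice_hop_right // splice_node_right // => hn _.
    rewrite (_ : n + (k + 1 - l) + 1 = n + 1 + (k + 1 - l)); last lia.
    by rewrite splice_node_right; [exact: f2|lia].
  + move=> m hm mk; move: hm; rewrite splice_hop_idx // splice_hop // !splice_node //; [|lia|lia].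
    by move=> hm; exact: b1.
- apply: splice_subwalks; [|exact: w2|by rewrite eH => v [<-]; exact: wh].
  move=> m v mk hm; case: c1 => [[w1 _]|e].
    by have [_ _ h1] := is_walk_inv w1; exact: h1 hm.
  by move: hm; rewrite /hop_idx /node_idx e; lia.
Qed.
End SpliceWalk.

(** * Joining walks at a wnode of natural rank *)

Lemma rle_antisym a b : rle a b -> rle b a -> a = b.
Proof. by move=> /rle_eqVlt[//|/negP]. Qed.

Lemma rsucc_neqV a b : rsucc a = Some b -> b <> ArrowOmega.
Proof. by case: a => [k| |] //= [<-]. Qed.

Lemma rsucc_le a b mu : rsucc a = Some b -> rlt a mu -> mu <> ArrowOmega ->
  rle b mu.
Proof.
case: a => [k| |] //= [<-]; case: mu => [m| |] //.
by rewrite /rlt /= -ltnNge.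
Qed.

Section Join.
Variables (nu : rank) (G : wdata).
Hypothesis hG : wgraph nu G.
Implicit Types (x y z p q : node G) (w v h : walk (node G)) (m : int).

Lemma hop_rank w m v : is_walk w -> hop_idx w m -> whop w m = Wk v ->
  wrank w <> ArrowOmega -> rlt (wrank v) (wrank w).
Proof.
move=> /is_walk_inv[_ + _] hm e; rewrite /walk_spec.
by case: (wrank w) => [[|k]| |] //; move=> hs _;
  [have [_ h2] := hs; have [b _ [e' _]] := h2 m hm; rewrite e in e'
  |have [_ _ h3 _] := hs; have [v' [e' ? _ _]] := h3 m hm;
   move: e'; rewrite e => -[->]
  |have [_ _ h3 _] := hs; have [v' [e' ? _ _]] := h3 m hm;
   move: e'; rewrite e => -[->]].
Qed.

(** Only the leading exponent of a length matters here: it is at most the rank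
for a two-ended walk and exactly the rank plus one for an infinite one. *)
Lemma walk_length_bound w : is_walk w -> forall mu, mu <> ArrowOmega ->
  (rlt (wrank w) mu -> ole (walk_length w) (omega_pow mu *+ 2)) /\
  (forall i j, wlo w = Some i -> whi w = Some j -> wrank w = mu ->
     exists N, ole (walk_length w) (omega_pow mu *+ N)).
Proof.
elim=> {}w hex hs hw IH mu muV; have ww : is_walk w by exact: IsWalk hex hs hw.
have fin mu' i j : mu' <> ArrowOmega -> wlo w = Some i -> whi w = Some j -> wrank w = mu' ->
    exists N, ole (walk_length w) (omega_pow mu' *+ N).
  move=> mu'V hi hj rw; rewrite (two_ended_length hi hj); set n := absz _.
  have hop_le k : (k < n)%N -> ole (hop_length (whop w (i + k%:Z))) (omega_pow mu' *+ 2).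
    move=> kn; have hm : hop_idx w (i + k%:Z).
      by rewrite /hop_idx /node_idx hi hj; move: kn (two_ended_lt ww hi hj); rewrite /n; lia.
    case E: (whop w (i + k%:Z)) => [b|v] /=.
      apply: (ole_trans (y := omega_pow mu')); last exact: ole_addr.
      case: mu' mu'V {rw} => [[|r]| |] // _.
        exact: (@omega_pow_mulrn_le (Fin 0) (Fin r.+1) 1).
      exact: (@omega_pow_mulrn_le (Fin 0) Omega 1).
    have [+ _] := IH _ _ hm E mu' mu'V; apply.
    by rewrite -rw; apply: hop_rank ww hm E _; rewrite rw.
  exists (2 * n)%N; rewrite mulrnA; elim: n hop_le => [|n IHn] hop_le.
    by rewrite big_nil; exact: ole0.
  rewrite big_nat_recr //= mulrSr; apply: ole_add; last exact: hop_le.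
  by apply: IHn => k kn; apply: hop_le; apply: ltnW.
split=> [ltw|i j]; last exact: fin.
case hi: (wlo w) => [i|]; case hj : (whi w) => [j|].
- have rV := two_ended_rank ww hi hj.
  have [N hN] := fin _ _ _ rV hi hj erefl.
  apply: ole_trans hN _; apply: (ole_trans (y := omega_pow mu)); last exact: ole_addr.
  exact: omega_pow_mulrn_le.
- have -> : walk_length w = one_ended_length (wrank w).
    by move: hi hj; case: (w) => ? ? ? ? ? /= -> ->.
  apply: ole_trans (one_ended_length_le muV ltw) _; exact: ole_addr.
- have -> : walk_length w = one_ended_length (wrank w).
    by move: hi hj; case: (w) => ? ? ? ? ? /= -> ->.
  apply: ole_trans (one_ended_length_le muV ltw) _; exact: ole_addr.
- have -> : walk_length w = one_ended_length (wrank w) *+ 2.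
    by move: hi hj; case: (w) => ? ? ? ? ? /= -> ->.
  by rewrite !mulr2n; apply: ole_add; apply: one_ended_length_le.
Qed.

Lemma reaches_right_tip_rank a mu w y : rsucc a = Some mu -> rle (rk y) mu ->
  reaches_right_tip a w y -> rk y = mu.
Proof.
move=> ea ry [rw hb]; rewrite /reaches_right hb => -[t [m [[p yp pt] _ tm]]].
have := tips_tail hG pt tm; rewrite rw ea => -[emu].
by apply: rle_antisym ry _; rewrite emu; exact: embraces_rle hG _ _ yp.
Qed.

Lemma reaches_left_tip_rank a mu w y : rsucc a = Some mu -> rle (rk y) mu ->
  reaches_left_tip a w y -> rk y = mu.
Proof. by move=> ea ry /reaches_right_tip_rev; apply: (reaches_right_tip_rank ea ry). Qed.

Section Sub.
Variables (rho : rank) (S : wsubgraph G).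
Hypothesis S_tips : forall t w p, rle (rk p) rho -> tips p t -> t w ->
  walk_within (snode S) (sbranch S) w -> snode S p.

(** The clauses on wtips are what makes joined walks usable as subwalks: when a
subwalk is replaced, the wtip through which it reached a neighbouring interior
wnode must not be lost. *)
Definition joined mu x y v1 v2 v :=
  [/\ walk_in S v, rle (wrank v) mu, reaches_left v x & reaches_right v y] /\
  (reaches_left_tip mu v1 x -> reaches_left_tip mu v x) /\
  (reaches_right_tip mu v2 y -> reaches_right_tip mu v y).

(** The error [omega_pow mu *+ 2] bounds the length of every walk of rank below
[mu], hence of the subwalk at the joint. *)
Definition short_join mu v1 v2 v := forall i j, wlo v1 = Some i -> whi v2 = Some j ->
  exists i' j', [/\ wlo v = Some i', whi v = Some j',
    wnode v i' = wnode v1 i, wnode v j' = wnode v2 j &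
    ole (walk_length v) (walk_length v1 + walk_length v2 + omega_pow mu *+ 2)].

Definition joinable a := forall x q y v1 v2,
  walk_in S v1 -> walk_in S v2 -> rle (wrank v1) a -> rle (wrank v2) a ->
  joint_rank a (rk q) -> snode S q ->
  reaches_left v1 x -> reaches_right v1 q -> reaches_left v2 q -> reaches_right v2 y ->
  exists v, joined a x y v1 v2 v.

(** [v'] can replace [v] where a walk of rank exactly [mu] is needed. *)
Definition closed_on_right mu v x v' :=
  [/\ walk_in S v', wrank v' = mu, reaches_left v' x,
      reaches_left_tip mu v x -> reaches_left_tip mu v' x &
      forall i, wlo v = Some i -> exists i', [/\ wlo v' = Some i',
        wnode v' i' = wnode v i & walk_length v' = walk_length v]].

Definition closed_on_left mu v y v' :=
  [/\ walk_in S v', wrank v' = mu, reaches_right v' y,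
      reaches_right_tip mu v y -> reaches_right_tip mu v' y &
      forall j, whi v = Some j -> exists j', [/\ whi v' = Some j',
        wnode v' j' = wnode v j & walk_length v' = walk_length v]].

Lemma rsucc_Some_lt a b : rsucc a = Some b -> rle b a -> False.
Proof. by move=> /rltS /negP. Qed.

(** A walk of lower rank becomes the only subwalk of a two-ended walk of rank
[mu]; a walk of rank [mu] cannot be infinite towards [q], whose rank is too
small to embrace a [mu]-wtip. *)
Lemma close_on_right a mu v x q : rsucc a = Some mu -> rle mu rho ->
  walk_in S v -> rle (wrank v) mu -> rle (rk q) mu -> snode S q ->
  reaches_left v x -> reaches_right v q ->
  exists v' j, [/\ closed_on_right mu v x v', whi v' = Some j & embraces q (wnode v' j)].
Proof.
move=> ea murho sv rv rq Sq vx vq; have [erv|ltv] := rle_eqVlt rv.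
  exists v; case hj : (whi v) => [j|].
    exists j; split; [|by []|by rewrite -(reaches_right_Some _ hj)].
    by split=> // i hi; exists i.
  have [p [qp _ _ [[b hb]|[_]]]] := end_right hG S_tips sv vq; first by rewrite hb in hj.
  rewrite erv => /rsucc_Some_lt; case.
  exact: rle_trans (embraces_rle hG qp) rq.
have [p [xp vp Sp hp]] := end_left hG S_tips sv vx.
have rp : rle (rk p) mu.
  case: hp => [[b hb ->]|[_ h]].
    exact: rle_trans (walk_node_rank sv.1 (wlo_node_idx sv.1 hb)) rv.
  exact: rsucc_le h ltv (rsucc_neqV ea).
pose w := Walk mu (Some 0) (Some 1) (fun m => if m == 0 then p else q) (fun=> Wk v).
have idx m : node_idx w m -> m = 0 \/ m = 1 by rewrite /node_idx /=; lia.
have hidx m : hop_idx w m -> m = 0 by rewrite /hop_idx /node_idx /=; lia.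
have iidx m : interior_idx w m -> False by rewrite /interior_idx /node_idx /=; lia.
have ww : is_walk w.
  constructor; first by exists 0.
    apply: (spec_walk_S (w := w) ea erefl); split=> m.
    - by move=> /idx[->|->].
    - by move=> /iidx.
    - by move=> /hidx ->; exists v.
    - by move=> /iidx.
  by move=> m u _ [<-]; exact: sv.1.
have win : walk_within (snode S) (sbranch S) w.
  constructor=> m.
  - by move=> /idx[->|->] //=; apply: Sp; apply: rle_trans rp murho.
  - by [].
  - by move=> u _ [<-]; exact: sv.2.
exists w, 1; split; [|by []|by constructor].
split; [exact: (conj ww win)|by []| | |].
- by rewrite (reaches_left_Some (w := w) _ erefl).
- by move=> [erv]; rewrite erv rlt_irr in ltv.
- move=> i hi; exists 0; split=> //.
    by case: hp => [[b hb /= ->]|[hn _]]; [move: hb; rewrite hi => -[->] | rewrite hi in hn].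
  by rewrite (two_ended_length (w := w) erefl erefl) big_nat1.
Qed.

Lemma closed_on_right_rev mu v x v' : is_walk v ->
  closed_on_right mu (rev_walk v) x (rev_walk v') -> closed_on_left mu v x v'.
Proof.
move=> wv [h1 h2 h3 h4 h5].
have sv' : walk_in S v' by rewrite -[v']rev_walkK; exact: walk_in_rev h1.
split.
- exact: sv'.
- by rewrite -h2 wrank_rev.
- by rewrite -reaches_left_rev.
- by move=> /reaches_left_tip_rev/h4/reaches_left_tip_rev.
- move=> j hj; have [|i [hi hn hl]] := h5 (- j); first by rewrite wlo_rev hj.
  exists (- i); split.
  + by move: hi; rewrite wlo_rev; case: (whi v') => //= ? [<-]; rewrite opprK.
  + by rewrite -wnode_rev hn wnode_rev opprK.
  + by rewrite -(walk_length_rev sv'.1) hl walk_length_rev.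
Qed.

Lemma close_on_left a mu v y q : rsucc a = Some mu -> rle mu rho ->
  walk_in S v -> rle (wrank v) mu -> rle (rk q) mu -> snode S q ->
  reaches_right v y -> reaches_left v q ->
  exists v' j, [/\ closed_on_left mu v y v', wlo v' = Some j & embraces q (wnode v' j)].
Proof.
move=> ea murho sv rv rq Sq vy vq.
have [|||v' [j [h1 h2 h3]]] := @close_on_right a mu (rev_walk v) y q ea murho (walk_in_rev sv) _ rq Sq.
- by rewrite wrank_rev.
- by rewrite reaches_left_rev.
- exact: vq.
exists (rev_walk v'), (- j); split.
- by apply: (closed_on_right_rev sv.1); rewrite rev_walkK.
- by rewrite wlo_rev h2.
- by rewrite wnode_rev opprK.
Qed.

Lemma splice_tip_left a v1 k H v2 l x : node_idx v1 k -> node_idx v2 l ->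
  reaches_left_tip a v1 x -> reaches_left_tip a (splice v1 k H v2 l) x.
Proof.
move=> hk hl [h1 h2 h3]; split; [exact: h1|exact: h2|].
exact: (splice_reaches_left hG H hk hl h3).
Qed.

Lemma splice_tip_right a v1 k H v2 l x : node_idx v2 l -> wrank v2 = wrank v1 ->
  reaches_right_tip a v2 x -> reaches_right_tip a (splice v1 k H v2 l) x.
Proof.
move=> hl e [h1 h2 h3]; split; [by rewrite /= -e|by rewrite /= h2|].
exact: (splice_reaches_right hG _ _ hl e h3).
Qed.

Lemma splice_joined mu x y v1 v2 v1' v2' j1 i2 k H l :
  let sp := splice v1' k H v2' l in
  closed_on_right mu v1 x v1' -> closed_on_left mu v2 y v2' ->
  whi v1' = Some j1 -> wlo v2' = Some i2 -> node_idx v1' k -> node_idx v2' l ->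
  ole (hop_length H) (omega_pow mu *+ 2) -> is_walk sp ->
  (forall b, H = Br b -> sbranch S b) ->
  (forall h, H = Wk h -> walk_within (snode S) (sbranch S) h) ->
  joined mu x y v1 v2 sp /\ short_join mu v1 v2 sp.
Proof.
move=> sp [s1 r1 L1 t1 e1] [s2 r2 R2' t2 e2] hj hi hk hl lenH wsp hb hw.
have er : wrank v2' = wrank v1' by rewrite r1.
have ssp : walk_in S sp by exact: (conj wsp (splice_within hk hl s1.2 s2.2 hb hw)).
split; [split; [split|split]|].
- exact: ssp.
- by rewrite /sp /= r1 rle_refl.
- exact: (splice_reaches_left hG _ hk hl L1).
- exact: (splice_reaches_right hG _ _ hl er R2').
- by move=> /t1; apply: splice_tip_left.
- by move=> /t2; apply: splice_tip_right.
- move=> i j /e1[i' [hi' ni le1]] /e2[j' [hj' nj le2]].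
  exists i', (j' + (k + 1 - l)); split.
  + by rewrite /sp /= hi'.
  + by rewrite /sp /= hj' /= addrC.
  + by rewrite splice_node //; move: hk; rewrite /node_idx hi' => /andP[].
  + by rewrite splice_node_right //; move: hl; rewrite /node_idx hj' => /andP[].
  + apply: ole_trans (splice_length _ hk hl hi' hj hi hj') _.
    rewrite le1 le2 -!addrA; apply: ole_add; first exact: ole_refl.
    by rewrite addrC; apply: ole_add; first exact: ole_refl.
Qed.

(** The hop [h] may follow the [k]-th wnode of [v1] in a walk of rank [mu]. *)
Definition attachable_left a mu v1 k h := [/\ node_idx v1 k, reaches_left h (wnode v1 k) &
  node_idx v1 (k - 1) -> rk (wnode v1 k) = mu /\
    ((exists2 v, whop v1 (k - 1) = Wk v & reaches_right_tip a v (wnode v1 k)) \/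
     reaches_left_tip a h (wnode v1 k))].

Definition attachable_right a mu v2 l h := [/\ node_idx v2 l, reaches_right h (wnode v2 l) &
  node_idx v2 (l + 1) -> rk (wnode v2 l) = mu /\
    (reaches_right_tip a h (wnode v2 l) \/
     exists2 v, whop v2 l = Wk v & reaches_left_tip a v (wnode v2 l))].

Lemma attach_joined a mu x y v1 v2 v1' v2' j1 i2 k l h : rsucc a = Some mu ->
  closed_on_right mu v1 x v1' -> closed_on_left mu v2 y v2' ->
  whi v1' = Some j1 -> wlo v2' = Some i2 ->
  walk_in S h -> rlt (wrank h) mu ->
  attachable_left a mu v1' k h -> attachable_right a mu v2' l h ->
  exists v, joined mu x y v1 v2 v /\ short_join mu v1 v2 v.
Proof.
move=> ea n1 n2 hj hi sh ltH [hk hL cL] [hl hR cR].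
exists (splice v1' k (Wk h) v2' l).
apply: (splice_joined n1 n2 hj hi hk hl).
- by have [lenh _] := walk_length_bound sh.1 (rsucc_neqV ea); apply: lenh.
- have [s1 r1 _ _ _] := n1; have [s2 r2 _ _ _] := n2.
  exact: (splice_is_walkS hk hl ea erefl s1.1 s2.1 r1 r2 sh.1 ltH hL hR cL cR).
- by [].
- by move=> _ [<-]; exact: sh.2.
Qed.

Lemma last_hop a mu w j : rsucc a = Some mu -> walk_in S w -> wrank w = mu ->
  whi w = Some j -> exists h, [/\ whop w (j - 1) = Wk h, walk_in S h,
    rlt (wrank h) mu, reaches_left h (wnode w (j - 1)) & reaches_right h (wnode w j)].
Proof.
move=> ea sw rw hj; have hm := whi_hop_idx sw.1 hj.
have [_ _ h3 _] := walk_spec_S sw.1 ea rw.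
have [h [eh rh hL hR]] := h3 _ hm; rewrite subrK in hR.
by exists h; split; [exact: eh|exact: (walk_in_hop sw hm eh)|exact: rh|exact: hL|exact: hR].
Qed.

Lemma first_hop a mu w i : rsucc a = Some mu -> walk_in S w -> wrank w = mu ->
  wlo w = Some i -> exists h, [/\ whop w i = Wk h, walk_in S h,
    rlt (wrank h) mu, reaches_left h (wnode w i) & reaches_right h (wnode w (i + 1))].
Proof.
move=> ea sw rw hi; have hm := wlo_hop_idx sw.1 hi.
have [_ _ h3 _] := walk_spec_S sw.1 ea rw.
have [h [eh rh hL hR]] := h3 _ hm.
by exists h; split; [exact: eh|exact: (walk_in_hop sw hm eh)|exact: rh|exact: hL|exact: hR].
Qed.

(** Juxtaposition: the whole of [w] is kept, and its last wnode becomes an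
interior one. *)
Lemma attachable_left_end a mu w j h1 h : walk_in S w -> whi w = Some j ->
  whop w (j - 1) = Wk h1 -> rk (wnode w j) = mu -> reaches_left h (wnode w j) ->
  reaches_right_tip a h1 (wnode w j) \/ reaches_left_tip a h (wnode w j) ->
  attachable_left a mu w j h.
Proof.
move=> sw hj e1 rj hL tip; split=> //; first exact: whi_node_idx sw.1 hj.
by move=> _; split=> //; case: tip => tip; [left; exists h1 | right].
Qed.

Lemma attachable_right_end a mu w i h2 h : walk_in S w -> wlo w = Some i ->
  whop w i = Wk h2 -> rk (wnode w i) = mu -> reaches_right h (wnode w i) ->
  reaches_left_tip a h2 (wnode w i) \/ reaches_right_tip a h (wnode w i) ->
  attachable_right a mu w i h.
Proof.
move=> sw hi e2 ri hR tip; split=> //; first exact: wlo_node_idx sw.1 hi.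
by move=> _; split=> //; case: tip => tip; [right; exists h2 | left].
Qed.

(** Replacement of the last hop [h1] of [w] by [h]: the wtip that [h1] may have
provided at its first wnode is still there. *)
Lemma attachable_left_prev a mu w j h1 h : rsucc a = Some mu -> walk_in S w -> wrank w = mu ->
  whi w = Some j -> whop w (j - 1) = Wk h1 -> reaches_left h (wnode w (j - 1)) ->
  (reaches_left_tip a h1 (wnode w (j - 1)) -> reaches_left_tip a h (wnode w (j - 1))) ->
  attachable_left a mu w (j - 1) h.
Proof.
move=> ea sw rw hj e1 hL tip; have /andP[hm hm'] := whi_hop_idx sw.1 hj.
split=> // hm1; have hint : interior_idx w (j - 1) by rewrite /interior_idx hm1.
have [_ h2 _ h4] := walk_spec_S sw.1 ea rw.
split; first exact: h2.
have [[v ev tv]|[v ev tv]] := h4 _ hint; first by left; exists v.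
by right; apply: tip; move: ev; rewrite e1 => -[->].
Qed.

Lemma attachable_right_next a mu w i h2 h : rsucc a = Some mu -> walk_in S w -> wrank w = mu ->
  wlo w = Some i -> whop w i = Wk h2 -> reaches_right h (wnode w (i + 1)) ->
  (reaches_right_tip a h2 (wnode w (i + 1)) -> reaches_right_tip a h (wnode w (i + 1))) ->
  attachable_right a mu w (i + 1) h.
Proof.
move=> ea sw rw hi e2 hR tip; have /andP[hm hm'] := wlo_hop_idx sw.1 hi.
have ei : i + 1 - 1 = i by lia.
split=> // hm1; have hint : interior_idx w (i + 1) by rewrite /interior_idx ei hm.
have [_ h2' _ h4] := walk_spec_S sw.1 ea rw.
split; first exact: h2'.
have [[v ev tv]|[v ev tv]] := h4 _ hint; last by right; exists v.
by left; apply: tip; move: ev; rewrite ei e2 => -[->].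
Qed.

(** Let [h1] and [h2] be the subwalks that meet.  If one of them arrives through
an [a]-wtip then its terminal wnode has rank [a + 1], so it is [q] itself, and
the walks are juxtaposed.  Otherwise [h1] and [h2] end at wnodes embraced by
[q] of rank at most [a], one of which embraces the other, and they are merged
there. *)
Lemma join_fin_succ a x q y v1 v2 : joinable (Fin a) -> rle (Fin a.+1) rho ->
  walk_in S v1 -> walk_in S v2 ->
  rle (wrank v1) (Fin a.+1) -> rle (wrank v2) (Fin a.+1) ->
  rle (rk q) (Fin a.+1) -> snode S q ->
  reaches_left v1 x -> reaches_right v1 q -> reaches_left v2 q -> reaches_right v2 y ->
  exists v, joined (Fin a.+1) x y v1 v2 v /\ short_join (Fin a.+1) v1 v2 v.
Proof.
set mu := Fin a.+1 => ja murho s1 s2 r1 r2 rq Sq L1 R1 L2 R2.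
have ea : rsucc (Fin a) = Some mu by [].
have [w1 [j [n1 hj qj]]] := close_on_right ea murho s1 r1 rq Sq L1 R1.
have [w2 [i [n2 hi qi]]] := close_on_left ea murho s2 r2 rq Sq R2 L2.
have [sw1 rw1 _ _ _] := n1; have [sw2 rw2 _ _ _] := n2.
have [h1 [e1 sh1 lt1 hL1 hR1]] := last_hop ea sw1 rw1 hj.
have [h2 [e2 sh2 lt2 hL2 hR2]] := first_hop ea sw2 rw2 hi.
have rkj : rle (rk (wnode w1 j)) mu by rewrite -rw1; exact: walk_node_rank sw1.1 (whi_node_idx sw1.1 hj).
have rki : rle (rk (wnode w2 i)) mu by rewrite -rw2; exact: walk_node_rank sw2.1 (wlo_node_idx sw2.1 hi).
have ready k l h := @attach_joined _ mu x y v1 v2 w1 w2 j i k l h ea n1 n2 hj hi.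
have [t1|nt1] := pselect (reaches_right_tip (Fin a) h1 (wnode w1 j)).
  have rj := reaches_right_tip_rank ea rkj t1.
  have eq := embraces_eq hG qj; rewrite rj in eq; have {}eq := eq rq.
  apply: (ready j (i + 1) h2 sh2 lt2).
    apply: attachable_left_end e1 rj _ _ => //; last by left.
    rewrite -eq; exact: reaches_left_trans qi hL2.
  by apply: attachable_right_next e2 _ _.
have [t2|nt2] := pselect (reaches_left_tip (Fin a) h2 (wnode w2 i)).
  have ri := reaches_left_tip_rank ea rki t2.
  have eq := embraces_eq hG qi; rewrite ri in eq; have {}eq := eq rq.
  apply: (ready (j - 1) i h1 sh1 lt1).
    by apply: attachable_left_prev e1 _ _.
  apply: attachable_right_end e2 ri _ _ => //; last by left.
  rewrite -eq; exact: reaches_right_trans qj hR1.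
have [p1 [yp1 hp1 Sp1 kp1]] : exists p, [/\ embraces (wnode w1 j) p, reaches_right h1 p,
    rle (rk p) rho -> snode S p & joint_rank (Fin a) (rk p)].
  exact: (end_right_small hG S_tips _ sh1 (rltS_le ea lt1) nt1 hR1).
have [p2 [yp2 hp2 Sp2 kp2]] : exists p, [/\ embraces (wnode w2 i) p, reaches_left h2 p,
    rle (rk p) rho -> snode S p & joint_rank (Fin a) (rk p)].
  exact: (end_left_small hG S_tips _ sh2 (rltS_le ea lt2) nt2 hL2).
have arho : rle (Fin a) rho by apply: rle_trans murho => /=.
have [p [kp Sp R1' L2']] : exists p, [/\ joint_rank (Fin a) (rk p), snode S p,
    reaches_right h1 p & reaches_left h2 p].
  have := embraces_down hG (embraces_trans qj yp1) (embraces_trans qi yp2).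
  case=> pp; [exists p1|exists p2]; split=> //.
  - exact: Sp1 (rle_trans kp1 arho).
  - exact: reaches_left_trans pp hp2.
  - exact: Sp2 (rle_trans kp2 arho).
  - exact: reaches_right_trans pp hp1.
have [h [[sh rh hL hR] [tL tR]]] :=
  ja _ _ _ _ _ sh1 sh2 (rltS_le ea lt1) (rltS_le ea lt2) kp Sp hL1 R1' L2' hR2.
apply: (ready (j - 1) (i + 1) h sh (rleS_lt ea rh)).
  by apply: attachable_left_prev e1 _ _.
by apply: attachable_right_next e2 _ _.
Qed.

(** A wnode of rank 0 embraces only itself, so both walks stop at [q]. *)
Lemma join_fin0 x q y v1 v2 :
  walk_in S v1 -> walk_in S v2 -> wrank v1 = Fin 0 -> wrank v2 = Fin 0 ->
  rk q = Fin 0 ->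
  reaches_left v1 x -> reaches_right v1 q -> reaches_left v2 q -> reaches_right v2 y ->
  exists v, joined (Fin 0) x y v1 v2 v /\ short_join (Fin 0) v1 v2 v.
Proof.
move=> s1 s2 r1 r2 rq L1 R1 L2 R2.
have end0 p : embraces q p -> p = q.
  by move=> qp; apply/esym; apply: (embraces_eq hG qp); rewrite rq; case: (rk p).
have [p1 [/end0 -> _ _ [[j hj e1]|[_]]]] := end_right hG S_tips s1 R1; last first.
  by rewrite r1 rq.
have [p2 [/end0 -> _ _ [[i hi e2]|[_]]]] := end_left hG S_tips s2 L2; last first.
  by rewrite r2 rq.
have hm := whi_hop_idx s1.1 hj.
have [_ + _] := is_walk_inv s1.1; rewrite /walk_spec r1 => -[_ h2].
have [b bb [eb bE]] := h2 _ hm; rewrite subrK -e1 e2 in bE.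
have /andP[hk _] := hm; have hl := wlo_node_idx s2.1 hi.
exists (splice v1 (j - 1) (Br b) v2 i).
apply: (splice_joined _ _ hj hi hk hl).
- by split=> // i0; exists i0.
- by split=> // i0; exists i0.
- by rewrite mulr2n; exact: ole_addr.
- by apply: splice_is_walk0 hk hl s1.1 s2.1 r1 r2 _; exists b.
- by move=> _ [<-]; have [_ h _] := walk_within_inv s1.2; apply: h hm eb.
- by [].
Qed.

(** The rank of [q] excludes arrival through an [a]-wtip, which keeps all the
merging inside the ranks up to [a]. *)
Lemma join_fin a x q y v1 v2 : rle (Fin a) rho ->
  walk_in S v1 -> walk_in S v2 -> rle (wrank v1) (Fin a) -> rle (wrank v2) (Fin a) ->
  rle (rk q) (Fin a) -> snode S q ->
  reaches_left v1 x -> reaches_right v1 q -> reaches_left v2 q -> reaches_right v2 y ->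
  exists v, joined (Fin a) x y v1 v2 v /\ short_join (Fin a) v1 v2 v.
Proof.
have rle0 r : rle r (Fin 0) -> r = Fin 0 by case: r => [[|r]| |].
elim: a x q y v1 v2 => [|a IHa] x q y v1 v2 arho s1 s2 r1 r2 rq Sq L1 R1 L2 R2.
  exact: join_fin0 s1 s2 (rle0 _ r1) (rle0 _ r2) (rle0 _ rq) L1 R1 L2 R2.
apply: (join_fin_succ _ arho s1 s2 r1 r2 rq Sq L1 R1 L2 R2).
move=> x' q' y' u1 u2 su1 su2 ru1 ru2 rq' Sq' Lu1 Ru1 Lu2 Ru2.
have arho' : rle (Fin a) rho by apply: rle_trans arho => /=.
by have [v [h _]] := IHa _ _ _ _ _ arho' su1 su2 ru1 ru2 rq' Sq' Lu1 Ru1 Lu2 Ru2; exists v.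
Qed.
End Sub.
End Join.

(** * Joining walks at ranks arrow-omega and omega *)

Section Arrow.
Variables (nu : rank) (G : wdata).
Hypothesis hG : wgraph nu G.
Implicit Types (x y z p q : node G) (w v h : walk (node G)) (m : int).

Lemma walk_in_whole w : is_walk w -> walk_in (whole G) w.
Proof.
elim=> {}w hex hs hw IH; have ww : is_walk w by exact: IsWalk hex hs hw.
apply: (conj ww); constructor.
- by [].
- move=> m b hm e; move: hs; rewrite /walk_spec.
  case: (wrank w) => [[|k]| |].
  + by move=> [_ h2]; have [b' bb [e' _]] := h2 _ hm; move: e'; rewrite e => -[->].
  + by move=> [_ _ h3 _]; have [v [e' _ _ _]] := h3 _ hm; rewrite e in e'.
  + move=> [c [_ _ _ hr hl]]; have [cm|mc] := leP c m.
      by have [v [r [s [e' _ _ _ _]]]] := hr _ hm cm; rewrite e in e'.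
    by have [v [r [s [e' _ _ _ _]]]] := hl _ hm mc; rewrite e in e'.
  + by move=> [_ _ h3 _]; have [v [e' _ _ _]] := h3 _ hm; rewrite e in e'.
- by move=> m v hm e; have [_ h] := IH _ _ hm e; exact: h.
Qed.

Let S := whole G.

Lemma whole_tips rho t w p : rle (rk p) rho -> tips p t -> t w ->
  walk_within (snode S) (sbranch S) w -> snode S p.
Proof. by []. Qed.

Lemma joined_rev mu x y v1 v2 v :
  joined S mu y x (rev_walk v2) (rev_walk v1) v -> joined S mu x y v1 v2 (rev_walk v).
Proof.
move=> [[sv rv L R] [tL tR]]; split; [split|split].
- exact: walk_in_rev sv.
- by rewrite wrank_rev.
- by rewrite reaches_left_rev.
- exact: L.
- by move=> /reaches_right_tip_rev/tR/reaches_left_tip_rev.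
- by move=> /reaches_left_tip_rev/tL/reaches_right_tip_rev.
Qed.

Lemma arrow_one_ended w c : is_walk w -> wrank w = ArrowOmega -> wlo w = Some c ->
  whi w = None /\ (forall m, hop_idx w m -> fwd_hop w m).
Proof.
move=> /is_walk_inv[_ + _] rw hc; rewrite /walk_spec rw.
move=> [c' [_ hlh [+ _] hr _]]; rewrite hc => ec; subst c'.
move: hlh; rewrite hc; case: (whi w) => // _; split=> // m hm.
have cm : c <= m by move: hm; rewrite /hop_idx /node_idx hc => /andP[/andP[]].
exact: (hr m hm cm).
Qed.

(** The subwalks of an arrow-omega-walk have increasing ranks, so joining them
one after the other at the intermediate wnodes always takes place at a wnode
of small enough rank. *)
Lemma fwd_prefix w c q n : is_walk w -> wrank w = ArrowOmega -> wlo w = Some c ->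
  reaches_left w q -> exists M s u,
    [/\ node_idx w M /\ c < M, (n <= s)%N, is_walk u /\ wrank u = Fin s, reaches_left u q &
        reaches_right_tip (Fin s) u (wnode w M) /\ rk (wnode w M) = Fin s.+1].
Proof.
move=> ww rw hc; rewrite (reaches_left_Some _ hc) => qc.
have [hhi hf] := arrow_one_ended ww rw hc.
have idx m : c <= m -> node_idx w m by rewrite /node_idx hc hhi => ->.
have hidx m : c <= m -> hop_idx w m by move=> cm; rewrite /hop_idx !idx //; lia.
have [_ _ sub] := is_walk_inv ww.
elim: n => [|n [M [s [u [[_ cM] ns [wu ru] uL [uR rM]]]]]].
  have hm := hidx c (lexx c); have [v [r [s [ev rv [_ r2] _ [vL vR]]]]] := hf _ hm.
  exists (c + 1), s, v; split.
  - by split; [apply: idx; lia|lia].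
  - by [].
  - exact: (conj (sub _ _ hm ev) rv).
  - exact: reaches_left_trans qc vL.
  - by split.
have hm := hidx M (ltW cM); have [v [r [s' [ev rv [r1 r2] rs' [vL vR]]]]] := hf _ hm.
have ss' : (s.+1 <= s')%N by move: r1; rewrite rM => -[rs]; move: rs'; rewrite -rs.
have wv := sub _ _ hm ev.
have [u' [[[su' ru' u'L u'R] [_ tR]] _]] : exists u', joined S (Fin s') q (wnode w (M + 1)) u v u' /\
    short_join (Fin s') u v u'.
  apply: (join_fin hG (@whole_tips (Fin s')) (q := wnode w M)).
  - exact: rle_refl.
  - exact: walk_in_whole.
  - exact: walk_in_whole.
  - by rewrite ru /= ltnW.
  - by rewrite rv /=.
  - by rewrite rM.
  - by [].
  - exact: uL.
  - by case: uR.
  - exact: vL.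
  - by case: vR.
have tR' := tR vR.
exists (M + 1), s', u'; split.
- by split; [apply: idx; lia|lia].
- exact: leq_ltn_trans ss'.
- by case: tR' => eu' _ _; exact: (conj su'.1 eu').
- exact: u'L.
- by [].
Qed.

(** A walk [u1] of natural rank is absorbed in an initial part of [v2] whose last
rank exceeds all those involved. *)
Lemma splice_arrow v1 v2 k r q t s1 u1 c : wrank v1 = ArrowOmega ->
  node_idx v1 k ->
  (is_walk v1 /\ wlo v1 = None \/ wlo v1 = Some k) ->
  (forall m, hop_idx v1 m -> m < k -> bwd_hop v1 m) ->
  rk (wnode v1 k) = Fin r -> is_walk u1 -> wrank u1 = Fin s1 ->
  reaches_left u1 (wnode v1 k) -> reaches_right u1 q -> rk q = Fin t ->
  is_walk v2 -> wrank v2 = ArrowOmega -> wlo v2 = Some c -> reaches_left v2 q ->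
  exists M h, node_idx v2 M /\ is_walk (splice v1 k (Wk h) v2 M).
Proof.
move=> r1 hk c1 b1 rk1 wu1 ru1 L1 R1 rq w2 r2 hc L2.
have [hhi hf] := arrow_one_ended w2 r2 hc.
have [M [s [u [[hM cM] ns [wu ru] uL [uR rM]]]]] := fwd_prefix (maxn r (maxn s1 t)) w2 r2 hc L2.
have [rs [s1s ts]] : (r <= s)%N /\ (s1 <= s)%N /\ (t <= s)%N by move: ns; rewrite !geq_max => /andP[? /andP[]].
have [h [[[sh rh hL hR] [_ tR]] _]] : exists h, joined S (Fin s) (wnode v1 k) (wnode v2 M) u1 u h /\
    short_join (Fin s) u1 u h.
  apply: (join_fin hG (@whole_tips (Fin s)) (q := q)).
  - exact: rle_refl.
  - exact: walk_in_whole.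
  - exact: walk_in_whole.
  - by rewrite ru1.
  - by rewrite ru rle_refl.
  - by rewrite rq.
  - by [].
  - exact: L1.
  - exact: R1.
  - exact: uL.
  - by case: uR.
have tR' := tR uR; have [eh _ _] := tR'.
exists M, h; split; first exact: hM.
by apply: (splice_is_walkV hk hM r1 erefl sh.1 c1 b1 w2 hhi _ eh rk1 rM _ hL tR') => // m /hf.
Qed.

Lemma fin_arrow_end_left v q : is_walk v -> wrank v = ArrowOmega ->
  reaches_left v q -> rlt (rk q) ArrowOmega -> exists c, wlo v = Some c.
Proof.
move=> wv rv vq rq; have [p [qp _ _ [[b hb _]|[_ h]]]] := end_left hG (@whole_tips Omega) (walk_in_whole wv) vq.
  by exists b.
have := embraces_rle hG qp; move: h rq; rewrite rv /= => -[<-].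
by case: (rk q).
Qed.

Lemma join_fin_arrow x q y v1 v2 s1 t : is_walk v1 -> is_walk v2 ->
  wrank v1 = Fin s1 -> wrank v2 = ArrowOmega -> rk q = Fin t ->
  reaches_left v1 x -> reaches_right v1 q -> reaches_left v2 q -> reaches_right v2 y ->
  exists v, joined S ArrowOmega x y v1 v2 v.
Proof.
move=> w1 w2 r1 r2 rq L1 R1 L2 R2.
have [c hc] : exists c, wlo v2 = Some c by apply: (fin_arrow_end_left w2 r2 L2); rewrite rq.
have [p [xp L1' _ hp]] := end_left hG (@whole_tips Omega) (walk_in_whole w1) L1.
have [r rp] : exists r, rk p = Fin r.
  case: hp => [[b hb ->]|[_]]; last by rewrite r1 => -[<-]; eexists.
  have := walk_node_rank w1 (wlo_node_idx w1 hb); rewrite r1.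
  by case: (rk _) => // r _; exists r.
(* The left part of the splice is the single wnode [p]. *)
pose D := Walk ArrowOmega (Some 0) (Some 0) (fun=> p) (fun=> Br set0) : walk (node G).
have hD : node_idx D 0 by [].
have [|M [h [hM wsp]]] := @splice_arrow D v2 0 r q t s1 v1 c erefl hD (or_intror erefl) _ rp w1 r1 L1' R1 rq w2 r2 hc L2.
  by move=> m; rewrite /hop_idx /node_idx /=; lia.
exists (splice D 0 (Wk h) v2 M); split; [split|split].
- exact: walk_in_whole wsp.
- by [].
- apply: (splice_reaches_left hG _ hD hM).
  by rewrite (reaches_left_Some (w := D) _ erefl).
- exact: (splice_reaches_right (v1 := D) hG _ _ hM r2 R2).
- by move=> [e]; rewrite r1 in e.
- exact: (splice_tip_right (v1 := D) hG _ _ hM r2).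
Qed.

(** An arrow-omega-walk that arrives at a wnode of natural rank does so with its
finite end, so each of the two walks is a natural one or one-ended with its
infinite end away from the joint. *)
Lemma joinable_arrow : joinable S ArrowOmega.
Proof.
move=> x q y v1 v2 [w1 _] [w2 _] r1 r2 rq _ L1 R1 L2 R2.
have [t rqt] : exists t, rk q = Fin t by case: (rk q) rq => // t; exists t.
case e1: (wrank v1) r1 => [s1| |] // _; case e2: (wrank v2) r2 => [s2| |] // _.
- pose a := maxn s1 (maxn s2 t).
  have [v [[[sv rv vL vR] _] _]] : exists v, joined S (Fin a) x y v1 v2 v /\ short_join (Fin a) v1 v2 v.
    apply: (join_fin hG (@whole_tips (Fin a)) (q := q)).
    + exact: rle_refl.
    + exact: walk_in_whole.
    + exact: walk_in_whole.
    + by rewrite e1 /= leq_max leqnn.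
    + by rewrite e2 /= !leq_max leqnn orbT.
    + by rewrite rqt /= !leq_max leqnn !orbT.
    + by [].
    + exact: L1.
    + exact: R1.
    + exact: L2.
    + exact: R2.
  exists v; split; [split|split].
  + exact: sv.
  + exact: rle_trans rv _.
  + exact: vL.
  + exact: vR.
  + by move=> [e]; rewrite e1 in e.
  + by move=> [e]; rewrite e2 in e.
- exact: join_fin_arrow w1 w2 e1 e2 rqt L1 R1 L2 R2.
- have [v hv] : exists v, joined S ArrowOmega y x (rev_walk v2) (rev_walk v1) v.
    apply: (join_fin_arrow (q := q) (is_walk_rev w2) (is_walk_rev w1) _ _ rqt).
    + by rewrite wrank_rev e2.
    + by rewrite wrank_rev e1.
    + by rewrite reaches_left_rev.
    + exact: L2.
    + by rewrite reaches_left_rev.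
    + exact: L1.
  by exists (rev_walk v); apply: joined_rev.
- have wr1 := is_walk_rev w1; have er1 : wrank (rev_walk v1) = ArrowOmega by rewrite wrank_rev.
  have Lr1 : reaches_left (rev_walk v1) q by rewrite reaches_left_rev.
  have [c hc] := fin_arrow_end_left w2 e2 L2 rq.
  have [c1 hc1] := fin_arrow_end_left wr1 er1 Lr1 rq.
  have [hhi1 hf1] := arrow_one_ended wr1 er1 hc1.
  have [M [s [u [[hM cM] _ [wu ru] uL [[_ _ uR] rM]]]]] := fwd_prefix 0 wr1 er1 hc1 Lr1.
  rewrite node_idx_rev in hM; rewrite wnode_rev in uR rM.
  have lo1 : wlo v1 = None by move: hhi1; rewrite whi_rev; case: (wlo v1).
  have [||||M' [h [hM' wsp]]] := @splice_arrow v1 v2 (- M) _ q t s (rev_walk u) c e1 hM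
    (or_introl (conj w1 lo1)) _ rM (is_walk_rev wu) _ _ _ rqt w2 e2 hc L2.
  + move=> m hm _; have [|v [r' [s' [ev rv [k1 k2] rs [vL vR]]]]] := hf1 (- m - 1).
      by rewrite hop_idx_rev (_ : - (- m - 1) - 1 = m) //; lia.
    move: ev k1 k2 vL vR; rewrite whop_rev !wnode_rev.
    rewrite (_ : - (- m - 1) - 1 = m); last lia.
    rewrite (_ : - (- m - 1) = m + 1); last lia.
    rewrite (_ : - (- m - 1 + 1) = m); last lia.
    move=> /rev_hop_Wk[v' ev' evv'] k1 k2; rewrite evv' reaches_left_rev => vL /reaches_right_tip_rev vR.
    by exists v', r', s'; split=> //; rewrite -rv evv' wrank_rev.
  + by rewrite wrank_rev.
  + by rewrite reaches_left_rev.
  + exact: uL.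
  exists (splice v1 (- M) (Wk h) v2 M'); split; [split|split].
  + exact: walk_in_whole wsp.
  + by rewrite /= e1.
  + exact: (splice_reaches_left hG _ hM hM' L1).
  + by apply: (splice_reaches_right hG _ _ hM'); rewrite ?e1.
  + exact: (splice_tip_left hG _ hM hM').
  + by apply: (splice_tip_right hG _ _ hM'); rewrite e1.
Qed.

(** A wnode of positive rank has a wtip; one of its representatives is followed
back from the wtip to its first wnode and out again. *)
Lemma loop_at p r : rk p = Fin r.+1 -> exists u,
  [/\ is_walk u, rle (wrank u) (Fin r), reaches_left u p & reaches_right u p].
Proof.
move=> rp; have [[t pt] twtip] := wg_tips_nonempty hG (erefl : rsucc (Fin r) = Some (Fin r.+1)) rp.
have [w [ww rw hlo hhi] et] := twtip t pt.
case hi: (wlo w) hlo => [i|] // _.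
have idx m : i <= m -> node_idx w m by rewrite /node_idx hi hhi => ->.
have wR : reaches_right w p.
  rewrite /reaches_right hhi; exists t, i; split; [by exists p => //; constructor|exact: idx|].
  rewrite et; split; first by split; [exact: (is_walk_tail ww hi hhi (lexx i))|exact: rw|by []|exact: hhi].
  exists 0, i => m im; rewrite addr0; split=> //; [|exact: idx|exact: same_hop_refl].
  by rewrite node_idx_tail hhi im.
have wL : reaches_left w (wnode w i) by rewrite (reaches_left_Some _ hi); constructor.
have [u [[[su ru uL uR] _] _]] : exists u, joined S (Fin r) p p (rev_walk w) w u /\
    short_join (Fin r) (rev_walk w) w u.
  apply: (join_fin hG (@whole_tips (Fin r)) (q := wnode w i)).
  - exact: rle_refl.
  - exact: walk_in_whole (is_walk_rev ww).
  - exact: walk_in_whole.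
  - by rewrite wrank_rev rw rle_refl.
  - by rewrite rw rle_refl.
  - by rewrite -rw; apply: walk_node_rank ww (idx _ (lexx i)).
  - by [].
  - by rewrite reaches_left_rev.
  - exact: wL.
  - exact: wL.
  - exact: wR.
by exists u; split; [exact: su.1|exact: ru|exact: uL|exact: uR].
Qed.

(** The cases are those of [join_fin_succ], with two indistinguishable wnodes
in place of a common one.  When a single one of the two meeting subwalks uses
an arrow-omega-wtip, [indist_Omega_embraces] shows that the other one reaches
the same omega-wnode; when both do, at different omega-wnodes, a loop connects
them. *)
Lemma join_Omega x y1 y2 y v1 v2 : is_walk v1 -> is_walk v2 -> indist y1 y2 ->
  rle (rk y1) Omega -> rle (rk y2) Omega ->
  reaches_left v1 x -> reaches_right v1 y1 -> reaches_left v2 y2 -> reaches_right v2 y ->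
  exists v, joined S Omega x y v1 v2 v /\ short_join Omega v1 v2 v.
Proof.
set mu := Omega => ww1 ww2 y12 ry1 ry2 L1 R1 L2 R2.
have s1 := walk_in_whole ww1; have s2 := walk_in_whole ww2.
have rO r : rle r mu by case: r.
have ea : rsucc ArrowOmega = Some mu by [].
have tipsO := @whole_tips mu.
have [w1 [j [n1 hj qj]]] := close_on_right hG tipsO ea (rle_refl _) s1 (rO _) ry1 I L1 R1.
have [w2 [i [n2 hi qi]]] := close_on_left hG tipsO ea (rle_refl _) s2 (rO _) ry2 I R2 L2.
have [sw1 rw1 _ _ _] := n1; have [sw2 rw2 _ _ _] := n2.
have [h1 [e1 sh1 lt1 hL1 hR1]] := last_hop ea sw1 rw1 hj.
have [h2 [e2 sh2 lt2 hL2 hR2]] := first_hop ea sw2 rw2 hi.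
have ready k l h := @attach_joined _ _ hG _ _ mu x y v1 v2 w1 w2 j i k l h ea n1 n2 hj hi.
set z1 := wnode w1 j in qj hR1; set z2 := wnode w2 i in qi hL2.
have z12 : indist z1 z2.
  apply: (indist_trans (y := y1)); first by apply: indist_sym; apply: rst_step.
  by apply: (indist_trans y12); apply: rst_step.
have nextl : attachable_left ArrowOmega mu w1 (j - 1) h1 by exact: (attachable_left_prev ea sw1 rw1 hj e1 hL1 id).
have nextr : attachable_right ArrowOmega mu w2 (i + 1) h2 by exact: (attachable_right_next ea sw2 rw2 hi e2 hR2 id).
have small1 : ~ reaches_right_tip ArrowOmega h1 z1 -> exists p, [/\ embraces z1 p,
    reaches_right h1 p, rle (rk p) mu -> snode S p & joint_rank ArrowOmega (rk p)].
  move=> nt; exact: (end_right_small hG tipsO _ sh1 (rltS_le ea lt1) nt hR1).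
have small2 : ~ reaches_left_tip ArrowOmega h2 z2 -> exists p, [/\ embraces z2 p,
    reaches_left h2 p, rle (rk p) mu -> snode S p & joint_rank ArrowOmega (rk p)].
  move=> nt; exact: (end_left_small hG tipsO _ sh2 (rltS_le ea lt2) nt hL2).
have okfin p : joint_rank ArrowOmega (rk p) -> exists r, rk p = Fin r.
  by case: (rk p) => // r; exists r.
have [t1|nt1] := pselect (reaches_right_tip ArrowOmega h1 z1);
  have [t2|nt2] := pselect (reaches_left_tip ArrowOmega h2 z2).
- have r1 := reaches_right_tip_rank hG ea (rO _) t1.
  have r2 := reaches_left_tip_rank hG ea (rO _) t2.
  have [e12|[p [r [rp p1 p2]]]] := indist_Omega_common hG r1 r2 z12.
    apply: (ready j (i + 1) h2 sh2 lt2) => //.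
    by apply: (attachable_left_end sw1 hj e1 r1); [rewrite -/z1 e12|left].
  have [u [wu ru uL uR]] := loop_at rp.
  apply: (ready j i u (walk_in_whole wu)).
  + by case: (wrank u) ru.
  + by apply: (attachable_left_end sw1 hj e1 r1); [exact: reaches_left_trans p1 uL|left].
  + by apply: (attachable_right_end sw2 hi e2 r2); [exact: reaches_right_trans p2 uR|left].
- have r1 := reaches_right_tip_rank hG ea (rO _) t1.
  have [p [zp hp _ /okfin[r rp]]] := small2 nt2.
  have z1p : embraces z1 p.
    apply: (indist_Omega_embraces hG rp r1); apply: indist_sym; apply: (indist_trans z12).
    exact: rst_step.
  apply: (ready j (i + 1) h2 sh2 lt2) => //.
  by apply: (attachable_left_end sw1 hj e1 r1); [exact: reaches_left_trans z1p hp|left].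
- have r2 := reaches_left_tip_rank hG ea (rO _) t2.
  have [p [zp hp _ /okfin[r rp]]] := small1 nt1.
  have z2p : embraces z2 p.
    apply: (indist_Omega_embraces hG rp r2); apply: (indist_trans _ z12).
    by apply: indist_sym; apply: rst_step.
  apply: (ready (j - 1) i h1 sh1 lt1) => //.
  by apply: (attachable_right_end sw2 hi e2 r2); [exact: reaches_right_trans z2p hp|left].
- have [p1 [zp1 hp1 _ ok1]] := small1 nt1; have [r1 rp1] := okfin _ ok1.
  have [p2 [zp2 hp2 _ ok2]] := small2 nt2; have [r2 rp2] := okfin _ ok2.
  have p12 : indist p1 p2.
    apply: (indist_trans (y := z1)); first by apply: indist_sym; apply: rst_step.
    by apply: (indist_trans z12); apply: rst_step.
  have [p [kp R1' L2']] : exists p, [/\ joint_rank ArrowOmega (rk p), reaches_right h1 p &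
      reaches_left h2 p].
    have [pp|pp] := indist_fin_comparable hG rp1 rp2 p12; [exists p1|exists p2]; split=> //.
      exact: reaches_left_trans pp hp2.
    exact: reaches_right_trans pp hp1.
  have [h [[sh rh hL hR] [tL tR]]] := joinable_arrow sh1 sh2 (rltS_le ea lt1)
    (rltS_le ea lt2) kp I hL1 R1' L2' hR2.
  apply: (ready (j - 1) (i + 1) h sh (rleS_lt ea rh)).
    exact: (attachable_left_prev ea sw1 rw1 hj e1 hL tL).
  exact: (attachable_right_next ea sw2 rw2 hi e2 hR tR).
Qed.
End Arrow.

(** * Wdistances *)

Section Distance.
Variables (nu : rank) (G : wdata) (rho : rank) (S : wsubgraph G).
Hypotheses (hG : wgraph nu G) (hconn : wconnected G nu) (rhoV : rho <> ArrowOmega)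
  (hS : wsection nu rho S).
Implicit Types (x y z p q : node G) (w : walk (node G)).

(** A wsection contains the wnodes in which its own one-ended walks arrive, by
the definition of the induced wsubgraph. *)
Lemma section_tips t w p : rle (rk p) rho -> tips p t -> t w ->
  walk_within (snode S) (sbranch S) w -> snode S p.
Proof.
case: hS => [[_ ->] //|[_ [Bs _ [-> _ _]]]] rp pt tw win.
split=> //; right; have [a ea ta] := tips_wtip hG pt.
exists a, t, w; split; [exact: ea|exact: ta|by exists p => //; constructor|exact: tw|].
elim: win => {tw} v _ hb _ IH; constructor.
- by [].
- exact: hb.
- exact: IH.
Qed.

Lemma section_Omega : rho = Omega -> S = whole G.
Proof. by move=> e; case: hS => [[_ ->] //|[+ _]]; rewrite e; case: nu. Qed.

Lemma two_ended_concat w1 w2 x y1 y2 z :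
  two_ended_in rho S w1 -> two_ended_in rho S w2 ->
  terminals w1 x y1 -> terminals w2 y2 z -> indist y1 y2 ->
  exists w, [/\ two_ended_in rho S w, terminals w x z &
    ole (walk_length w) (walk_length w1 + walk_length w2 + omega_pow rho *+ 2)].
Proof.
move=> [ww1 rw1 _ in1] [ww2 rw2 _ in2] [i1 [j1 [hi1 hj1 ex ey1]]] [i2 [j2 [hi2 hj2 ey2 ez]]] y12.
have L1 : reaches_left w1 x by rewrite (reaches_left_Some _ hi1) ex; constructor.
have R1 : reaches_right w1 y1 by rewrite (reaches_right_Some _ hj1) ey1; constructor.
have L2 : reaches_left w2 y2 by rewrite (reaches_left_Some _ hi2) ey2; constructor.
have R2 : reaches_right w2 z by rewrite (reaches_right_Some _ hj2) ez; constructor.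
have hn1 := whi_node_idx ww1 hj1; have hn2 := wlo_node_idx ww2 hi2.
have r1 : rle (rk y1) rho by rewrite -ey1; exact: rle_trans (walk_node_rank ww1 hn1) rw1.
have r2 : rle (rk y2) rho by rewrite -ey2; exact: rle_trans (walk_node_rank ww2 hn2) rw2.
have S1 : snode S y1 by rewrite -ey1; exact: (walk_in_node (conj ww1 in1) hn1).
have S2 : snode S y2 by rewrite -ey2; exact: (walk_in_node (conj ww2 in2) hn2).
suff [v [[[sv rv _ _] _] sj]] : exists v, joined S rho x z w1 w2 v /\ short_join rho w1 w2 v.
  have [i [j [hi hj ei ej lenv]]] := sj _ _ hi1 hj2.
  exists v; split; last exact: lenv.
    by split; [exact: sv.1|exact: rv|rewrite hi hj|exact: sv.2].
  by exists i, j; split; rewrite ?ei ?ej.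
case e : rho rhoV => [a| |] // _.
- have [[f1 rf1] [f2 rf2]] : (exists f, rk y1 = Fin f) /\ (exists f, rk y2 = Fin f).
    move: r1 r2; rewrite e; case: (rk y1) => // f1 _; case: (rk y2) => // f2 _.
    by split; eexists.
  have [q [rq Sq R1' L2']] : exists q, [/\ rle (rk q) (Fin a), snode S q,
      reaches_right w1 q & reaches_left w2 q].
    have [yy|yy] := indist_fin_comparable hG rf1 rf2 y12; [exists y1|exists y2]; split=> //.
    + by rewrite -e.
    + exact: reaches_left_trans yy L2.
    + by rewrite -e.
    + exact: reaches_right_trans yy R1.
  have tipsa := section_tips; rewrite e in tipsa rw1 rw2.
  exact: (join_fin hG tipsa (rle_refl _) (conj ww1 in1) (conj ww2 in2) rw1 rw2 rq Sq L1 R1' L2' R2).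
- rewrite (section_Omega e); rewrite e in r1 r2.
  exact: (join_Omega hG ww1 ww2 y12 r1 r2 L1 R1 L2 R2).
Qed.

Local Notation d := (wdist rho S).
Local Notation o := (omega_pow rho).

Lemma wdist_set_neq0 x y : snode S x -> snode S y -> wdist_set rho S x y !=set0.
Proof.
move=> Sx Sy; have [xy|nxy] := pselect (indist x y); first by exists 0; left.
suff [w tw jw] : exists2 w, two_ended_in rho S w & joins w x y.
  by exists (walk_length w); right; exists w.
case: hS => [[-> ->]|[_ [Bs _ [_ conn _]]]]; first exact: hconn.
have [|w tw trm] := conn x y Sx Sy; first by move=> e; apply: nxy; rewrite e; constructor.
by exists w => //; exists x, y; split=> //; constructor.
Qed.

Lemma wdistP x y : wdist_set rho S x y !=set0 ->
  wdist_set rho S x y (d x y) /\ forall l, wdist_set rho S x y l -> ole (d x y) l.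
Proof.
move=> /ord_min [l hl lmin].
by apply: (@xgetPex _ 0 [set l | wdist_set rho S x y l /\
   forall l', wdist_set rho S x y l' -> ole l l']); exists l.
Qed.

Lemma wdist_le x y l : wdist_set rho S x y l -> ole (d x y) l.
Proof. by move=> hl; have [|_] := @wdistP x y; [exists l|apply]. Qed.

Lemma wdist_mem x y : snode S x -> snode S y -> wdist_set rho S x y (d x y).
Proof. by move=> Sx Sy; have [] := wdistP (wdist_set_neq0 Sx Sy). Qed.

Lemma two_ended_rev w : two_ended_in rho S w -> two_ended_in rho S (rev_walk w).
Proof.
move=> [ww rw te win]; split.
- exact: is_walk_rev.
- by rewrite wrank_rev.
- by move: te; rewrite wlo_rev whi_rev; case: (wlo w); case: (whi w).
- exact: walk_within_rev.
Qed.

Lemma terminals_rev w x y : terminals w x y -> terminals (rev_walk w) y x.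
Proof.
move=> [i [j [hi hj ei ej]]]; exists (- j), (- i).
by rewrite wlo_rev whi_rev hi hj !wnode_rev !opprK.
Qed.

Lemma wdist_sym x y : snode S x -> snode S y -> ole (d x y) (d y x).
Proof.
move=> Sx Sy; apply: wdist_le; case: (wdist_mem Sy Sx) => [[yx ->]|[w [tw jw ->]]].
  by left; split=> //; apply: indist_sym.
right; exists (rev_walk w); split.
- exact: two_ended_rev.
- have [y' [x' [yy' xx' trm]]] := jw; exists x', y'.
  by split=> //; exact: terminals_rev.
- by have [ww _ _ _] := tw; rewrite (walk_length_rev ww).
Qed.

Lemma wdist_eq0 x : ole (d x x) 0.
Proof. by apply: wdist_le; left; split=> //; constructor. Qed.

(** Passing through a wnode [y] costs at most the length of one hop, by
[two_ended_concat]. *)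
Lemma wdist_triangle x y z : snode S x -> snode S y -> snode S z ->
  ole (d x z) (d x y + d y z + o *+ 2).
Proof.
move=> Sx Sy Sz.
have [[xy ->]|[w1 [tw1 j1 ->]]] := wdist_mem Sx Sy.
  rewrite add0r; apply: (ole_trans (y := d y z)); last exact: ole_addr.
  apply: wdist_le; have [[yz ->]|[w [tw j ->]]] := wdist_mem Sy Sz.
    by left; split=> //; apply: indist_trans yz.
  right; exists w; split=> //; have [y' [z' [yy' zz' trm]]] := j.
  by exists y', z'; split=> //; apply: indist_trans yy'.
have [[yz ->]|[w2 [tw2 j2 ->]]] := wdist_mem Sy Sz.
  rewrite addr0; apply: (ole_trans (y := walk_length w1)); last exact: ole_addr.
  apply: wdist_le; right; exists w1; split=> //; have [x' [y' [xx' yy' trm]]] := j1.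
  by exists x', y'; split=> //; apply: indist_trans (indist_sym yz) yy'.
have [x' [y1 [xx' yy1 trm1]]] := j1; have [y2 [z' [yy2 zz' trm2]]] := j2.
have [w [tw trm lenw]] := two_ended_concat tw1 tw2 trm1 trm2 (indist_trans (indist_sym yy1) yy2).
apply: ole_trans lenw; apply: wdist_le; right; exists w; split=> //.
by exists x', z'.
Qed.

Lemma wdist_move_right x y z n : snode S x -> snode S y -> snode S z ->
  ole (d y z) (o *+ n) -> ole (d x z) (d x y + o *+ (n + 2)).
Proof.
move=> Sx Sy Sz yz; apply: ole_trans (wdist_triangle Sx Sy Sz) _.
rewrite (mulrnDr o n 2) (addrA (d x y)); apply: ole_add2r.
by apply: ole_add => //; exact: ole_refl.
Qed.

Lemma wdist_move_left x y z n : snode S x -> snode S y -> snode S z ->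
  ole (d x y) (o *+ n) -> ole (d x z) (d y z + o *+ (n + 2)).
Proof.
move=> Sx Sy Sz xy; apply: ole_trans (wdist_triangle Sx Sy Sz) _.
rewrite (mulrnDr o n 2) (addrA (d y z)) [d y z + _]addrC; apply: ole_add2r.
by apply: ole_add => //; exact: ole_refl.
Qed.

(** The bound depends on [x] and [y]; it is used only for pairs of fixed wnodes,
behind standard hypernodes. *)
Lemma wdist_bounded x y : snode S x -> snode S y -> exists N, ole (d x y) (o *+ N).
Proof.
move=> Sx Sy; have [[_ ->]|[w [[ww rw te _] _ ->]]] := wdist_mem Sx Sy.
  by exists 0%N; exact: ole0.
have [h1 h2] := walk_length_bound ww rhoV.
have [er|ltr] := rle_eqVlt rw; last by exists 2; apply: h1.
case hi: (wlo w) te => [i|]; case hj: (whi w) => [j|] // _.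
exact: h2 hi hj er.
Qed.

(** * Galaxies and closeness *)

Section Galaxies.
Variable F : set_system nat.
Hypothesis FF : ProperFilter F.
Implicit Types (u v : nat -> node G) (h k : set (nat -> node G)).

Definition in_section u := forall n, snode S (u n).

Definition limited u v := exists mu : nat, F [set n | ole (d (u n) (v n)) (o *+ mu)].

Lemma limited_aeq u v : F [set n | u n = v n] -> limited u v.
Proof.
by move=> huv; exists 0%N; apply: filterS huv => n /= ->; exact: wdist_eq0.
Qed.

Lemma limited_sym u v : in_section u -> in_section v -> limited u v -> limited v u.
Proof.
move=> Su Sv [m hm]; exists m; apply: filterS hm => n /=.
exact: ole_trans (wdist_sym (Sv n) (Su n)).
Qed.

Lemma limited_trans v u (w : nat -> node G) : in_section u -> in_section v -> in_section w ->
  limited u v -> limited v w -> limited u w.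
Proof.
move=> Su Sv Sw [m hm] [m' hm']; exists (m + m' + 2)%N.
apply: filterS (filterI hm hm') => n /= [h1 h2].
apply: ole_trans (wdist_move_right (Su n) (Sv n) (Sw n) h2) _.
by rewrite -addnA (mulrnDr o m (m' + 2)); apply: ole_add2r.
Qed.

Lemma hypernode_mem h u : is_hypernode F S h -> h u -> in_section u.
Proof. by move=> [g [x _ ->]] [hu _] n; case: (hu n). Qed.

Lemma hypernode_lim h u v : is_hypernode F S h -> h u -> h v -> limited u v.
Proof.
move=> [g [x _ ->]] [_ hu] [_ hv]; apply: limited_aeq.
by apply: filterS (filterI hu hv) => n /= [<- <-].
Qed.

Lemma limitedly_distant_lim h k u v : is_hypernode F S h -> is_hypernode F S k ->
  limitedly_distant F rho S h k -> h u -> k v -> limited u v.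
Proof.
move=> hh hk [u0 [v0 [hu0 kv0 l0]]] hu kv.
have Su0 := hypernode_mem hh hu0; have Sv0 := hypernode_mem hk kv0.
have Su := hypernode_mem hh hu; have Sv := hypernode_mem hk kv.
apply: (limited_trans Su Su0 Sv (hypernode_lim hh hu hu0)).
exact: (limited_trans Su0 Sv0 Sv l0 (hypernode_lim hk kv0 kv)).
Qed.

Lemma galaxy_lim Ga h k u v : galaxy F rho S Ga -> hnodes Ga h -> hnodes Ga k ->
  h u -> k v -> limited u v.
Proof.
move=> [P [c hc ->] ->] /= [hh ch] [hk ck] hu kv.
have [c0 cc0] : exists c0, c c0 by case: ch => x [y [cx _ _]]; exists x.
have Sc := hypernode_mem hc cc0.
have Su := hypernode_mem hh hu; have Sv := hypernode_mem hk kv.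
apply: (limited_trans Su Sc Sv); last exact: limitedly_distant_lim hc hk ck cc0 kv.
exact: limited_sym Sc Su (limitedly_distant_lim hc hh ch cc0 hu).
Qed.

(** Two standard hypernodes are limitedly distant, as each comes from a single
wnode. *)
Lemma principal_lim h k u v : hnodes (principal_galaxy F rho S) h ->
  hnodes (principal_galaxy F rho S) k -> h u -> k v -> limited u v.
Proof.
move=> /= [hh [s [x Sx es] sh]] [hk [t [y Sy et] tk]] hu kv.
have hypc z : snode S z -> is_hypernode F S (node_class F S (rk z) (fun=> z)).
  by move=> Sz; exists (rk z), (fun=> z).
have memc z : snode S z -> node_class F S (rk z) (fun=> z) (fun=> z).
  by move=> Sz; split=> //; exact: filterS filterT.
subst s t.
have Su := hypernode_mem hh hu; have Sv := hypernode_mem hk kv.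
have Sxc : in_section (fun=> x) by [].
have Syc : in_section (fun=> y) by [].
have xu := limitedly_distant_lim (hypc x Sx) hh sh (memc x Sx) hu.
have yv := limitedly_distant_lim (hypc y Sy) hk tk (memc y Sy) kv.
have xy : limited (fun=> x) (fun=> y).
  have [N hN] := wdist_bounded Sx Sy; exists N; exact: filterS filterT.
exact: (limited_trans Su Sxc Sv (limited_sym Sxc Su xu) (limited_trans Sxc Syc Sv xy yv)).
Qed.

(** The galaxy of [z] and [y'] is between those of [y] and [z']: the gap from [y']
to [z'], seen from [x'], is also a gap from [y] to [z'], seen from [x], up to
the finite errors [mu] and [mu'] made in moving from [z] to [y'] and from [x]
to [x']. *)
Lemma gap_chain (x x' y y' z z' : node G) (m0 mu mu' : nat) :
  snode S x -> snode S x' -> snode S y' -> snode S z -> snode S z' ->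
  ole (d x x') (o *+ mu') -> ole (d z y') (o *+ mu) ->
  ole (d y x) (d z x) ->
  ole (d y' x' + o *+ (m0 + (mu' + 2 + (mu' + 2 + (mu + 2))))) (d z' x') ->
  ole (d y x + o *+ m0) (d z' x).
Proof.
move=> Sx Sx' Sy' Sz Sz' hxx' hzy' h1 h2; set N := (mu' + 2 + (mu + 2))%N in h2.
have a1 : ole (d z' x') (d z' x + o *+ (mu' + 2)) by exact: wdist_move_right.
have a2 : ole (d y' x) (d y' x' + o *+ (mu' + 2)).
  apply: wdist_move_right => //; exact: ole_trans (wdist_sym Sx' Sx) hxx'.
have a3 : ole (d z x) (d y' x + o *+ (mu + 2)) by exact: wdist_move_left.
have a4 : ole (d y x) (d y' x' + o *+ N) := ole_trans h1 (ole_slack_trans a3 a2).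
apply: (@ole_cancel (o *+ (mu' + 2 + N))); rewrite -addrA -mulrnDr.
apply: ole_trans (ole_add2r _ a4) _.
rewrite addrAC (mulrnDr o (mu' + 2) N) (addrA (d z' x)).
exact: ole_add2r _ (ole_trans h2 a1).
Qed.

Lemma closer_trans Ga Gb Gc : galaxy F rho S Gb ->
  closer F rho S Ga Gb -> closer F rho S Gb Gc -> closer F rho S Ga Gc.
Proof.
move=> gb [gy [gz [gx [hy [hz [hx [y [z [x [[gy1 gz1 gx1] [Hy Hz Hx] [Ay Bz Px] [yy zz xx] gap]]]]]]]]]].
move=> [gy' [gz' [gx' [hy' [hz' [hx' [y' [z' [x' [[gy1' gz1' gx1'] [Hy' Hz' Hx'] [By' Cz' Px'] [yy' zz' xx'] gap']]]]]]]]]].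
exists gy, gz', gx, hy, hz', hx, y, z', x; split=> // m0.
have ish g h : hypernode F S g h -> is_hypernode F S h by move=> hh; exists g.
have Sx := hypernode_mem (ish _ _ Hx) xx; have Sx' := hypernode_mem (ish _ _ Hx') xx'.
have Sy := hypernode_mem (ish _ _ Hy) yy; have Sy' := hypernode_mem (ish _ _ Hy') yy'.
have Sz := hypernode_mem (ish _ _ Hz) zz; have Sz' := hypernode_mem (ish _ _ Hz') zz'.
have [mu hmu] := galaxy_lim gb Bz By' zz yy'.
have [mu' hmu'] := principal_lim Px Px' xx xx'.
apply: filterS (filterI (filterI hmu hmu') (filterI (gap 0%N)
  (gap' (m0 + (mu' + 2 + (mu' + 2 + (mu + 2))))%N))) => n /= [[h1 h2] [h3 h4]].
apply: (gap_chain (Sx n) (Sx' n) (Sy' n) (Sz n) (Sz' n) h2 h1 _ h4).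
by move: h3; rewrite mulr0n addr0.
Qed.

(** Inside a galaxy the triangle inequality bounds the gap by a fixed multiple of
omega^rho. *)
Lemma closer_irr Ga : galaxy F rho S Ga -> ~ closer F rho S Ga Ga.
Proof.
move=> ga [gy [gz [gx [hy [hz [hx [y [z [x [_ [Hy Hz Hx] [Ay Az Px] [yy zz xx] gap]]]]]]]]]].
have ish g h : hypernode F S g h -> is_hypernode F S h by move=> hh; exists g.
have Sx := hypernode_mem (ish _ _ Hx) xx.
have Sy := hypernode_mem (ish _ _ Hy) yy; have Sz := hypernode_mem (ish _ _ Hz) zz.
have [mu hmu] := galaxy_lim ga Az Ay zz yy.
apply: (@filter_not_empty _ F _); apply: filterS (filterI hmu (gap (mu + 3)%N)) => n /= [h1 h2].
have h3 := ole_trans h2 (wdist_move_left (Sz n) (Sy n) (Sx n) h1).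
have h4 : ole (o + (d (y n) (x n) + o *+ (mu + 2))) (0 + (d (y n) (x n) + o *+ (mu + 2))).
  by rewrite add0r addrCA -mulrS -(addnS mu 2).
exact: (ole_olt_false (ole_cancel h4) (omega_pow_gt0 rho)).
Qed.

Lemma closeness_partial_order :
  partial_order_on (galaxy F rho S)
    (fun Ga Gb => Ga = Gb \/ closer F rho S Ga Gb).
Proof.
split=> [a _|a b ga gb|a b c _ gb _]; first by left.
- move=> [-> //|ab] [-> //|ba].
  by case: (closer_irr ga (closer_trans gb ab ba)).
- move=> [-> //|ab] [<-|bc]; first by right.
  by right; exact: closer_trans gb ab bc.
Qed.
End Galaxies.
End Distance.

(** * The theorem *)

Theorem theorem5p2 (F : set_system nat) (hF : free_ultrafilter F)
  (nu : rank) (hnu : rle (Fin 2) nu)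
  (G : wdata) (hG : wgraph nu G) (hconn : wconnected G nu)
  (rho : rank) (hrho : rle rho nu) (hrho' : rho <> ArrowOmega)
  (S : wsubgraph G) (hS : wsection nu rho S)
  (hyp : exists2 h, hypernode F S rho h &
           ~ hnodes (principal_galaxy F rho S) h) :
  partial_order_on (galaxy F rho S)
    (fun Ga Gb => Ga = Gb \/ closer F rho S Ga Gb).
Proof.
have [FF _] := hF.
exact: closeness_partial_order hG hconn hrho' hS F _.
Qed.
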